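(* Let $G$ be a (finite) maximal triangle-free graph which contains the Mycielski–Grötzsch graph $\Upsilon$ as a subgraph and satisfies property $\mathscr{D}_4$. Then $G$ is a blow-up of some Vega graph $\Upsilon_i^{\mu\nu}$ ($i\ge2$, $\mu,\nu\in\{0,1\}$).
   Context: A graph is maximal triangle-free if it contains no triangle but adding any new edge creates a triangle. A blow-up of $H$ is any graph obtained by replacing each vertex of $H$ by a non-empty independent set and each edge of $H$ by the complete bipartite graph between the corresponding sets, with no further edges. Property $\mathscr{D}_k$: for every $m\in\{1,\dots,k\}$ and every sequence $x_1,\dots,x_{3m}$ of (not necessarily distinct) vertices there is a vertex $y$ with $|\{i\in[3m]: x_iy\in E(G)\}|\ge m+1$. Mycielski–Grötzsch graph $\Upsilon$: vertices $a_j,b_j$ ($j\in\mathbb Z/5\mathbb Z$) and $c$; edges all pairs $a_jc$, $a_jb_{j\pm2}$, $b_jb_{j+2}$. Andrásfai graph $\Gamma_i$: vertex set $\mathbb Z/(3i-1)\mathbb Z$, $jm$ an edge iff $j-m\in\{i,\dots,2i-1\}$ mod $3i-1$. Vega graphs: for $i\ge2$, $\Upsilon_i^{00}$ has vertex set $\mathbb Z/(3i-1)\mathbb Z\cup\{a,b,c,u,v,w,x,y\}$; edges: those of $\Gamma_i$; the hexagon $av,vc,cu,ub,bw,wa$; all edges from $a,u$ to $\{0,\dots,i-1\}$; from $b,v$ to $\{i,\dots,2i-1\}$; from $c,w$ to $\{2i,\dots,3i-2\}$; and $xa,xb,xc,yu,yv,yw,xy$. Further $\Upsilon_i^{10}=\Upsilon_i^{00}-y$,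 $\Upsilon_i^{01}=\Upsilon_i^{00}-(2i-1)$, $\Upsilon_i^{11}=\Upsilon_i^{00}-\{y,2i-1\}$. *)

(* Defs.v *)
From mathcomp Require Import all_boot.
Set Implicit Arguments. Unset Strict Implicit. Unset Printing Implicit Defensive.

Definition simple_graph (T : finType) (e : rel T) : Prop :=
  symmetric e /\ irreflexive e.

Definition triangle_free (T : finType) (e : rel T) : Prop :=
  forall x y z : T, ~ [&& e x y, e y z & e x z].

Definition maximal_triangle_free (T : finType) (e : rel T) : Prop :=
  triangle_free e /\
  forall x y : T, x != y -> ~~ e x y -> exists z : T, e x z && e z y.

Definition property_D (k : nat) (T : finType) (e : rel T) : Prop :=
  forall m : nat, 1 <= m <= k ->
  forall xs : 'I_(3 * m) -> T,
  exists y : T, m.+1 <= #|[set i : 'I_(3 * m) | e (xs i) y]|.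

Definition contains_subgraph (U T : finType) (h : rel U) (e : rel T) : Prop :=
  exists phi : U -> T, injective phi /\
    forall x y : U, h x y -> e (phi x) (phi y).

(* G (on T, adjacency e) is a blow-up of the graph with vertex set S and
   adjacency h restricted to S: there is a map f onto S whose fibres are the
   blown-up classes, with xy an edge iff f x f y is an edge. (Fibres are
   independent because h is irreflexive; surjectivity = classes non-empty.) *)
Definition blowup_of (T V : finType) (e : rel T) (h : rel V) (S : pred V) : Prop :=
  exists f : T -> V,
    (forall x, f x \in S) /\
    (forall v, v \in S -> exists x, f x = v) /\
    (forall x y : T, e x y = h (f x) (f y)).

(* Mycielski–Grötzsch graph: Some (inl j) = a_j, Some (inr j) = b_j, None = c. *)
Definition MG_vertex := option ('I_5 + 'I_5)%type.

Definition MG_base (p q : MG_vertex) : bool :=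
  match p, q with
  | Some (inl j), None => true
  | Some (inl j), Some (inr k) => (k == (j + 2) %% 5 :> nat) || ((k + 2) %% 5 == j :> nat)
  | Some (inr j), Some (inr k) => k == (j + 2) %% 5 :> nat
  | _, _ => false
  end.

Definition MG_adj : rel MG_vertex := fun p q => MG_base p q || MG_base q p.

(* Vega graphs. Vertices: inl j for j in Z/(3i-1)Z, and inr p, p : 'I_8 with
   a=0, b=1, c=2, u=3, v=4, w=5, x=6, y=7. *)
Definition vega_vertex (i : nat) := ('I_(3 * i - 1) + 'I_8)%type.

Definition andrasfai_adj (i : nat) (j m : nat) : bool :=
  let n := 3 * i - 1 in i <= (j + n - m) %% n < 2 * i.

Definition vega_hex_edges : seq (nat * nat) :=
  [:: (0, 4); (4, 2); (2, 3); (3, 1); (1, 5); (5, 0);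
      (6, 0); (6, 1); (6, 2); (7, 3); (7, 4); (7, 5); (6, 7)].

Definition vega_base (i : nat) (p q : vega_vertex i) : bool :=
  match p, q with
  | inl j, inl m => andrasfai_adj i j m
  | inr s, inl j =>
      ((s == 0 :> nat) || (s == 3 :> nat)) && (j < i)
   || ((s == 1 :> nat) || (s == 4 :> nat)) && (i <= j < 2 * i)
   || ((s == 2 :> nat) || (s == 5 :> nat)) && (2 * i <= j)
  | inr s, inr t => (nat_of_ord s, nat_of_ord t) \in vega_hex_edges
  | inl _, inr _ => false
  end.

Definition vega_adj (i : nat) : rel (vega_vertex i) :=
  fun p q => vega_base p q || vega_base q p.

Definition vega_set (i : nat) (mu nu : bool) : pred (vega_vertex i) :=
  fun p => match p with
           | inl j => ~~ (nu && (nat_of_ord j == 2 * i - 1))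
           | inr s => ~~ (mu && (nat_of_ord s == 7))
           end.

(* Main.v *)
Require Import Defs.
From mathcomp Require Import all_boot.
From mathcomp Require Import zify.
Set Implicit Arguments. Unset Strict Implicit. Unset Printing Implicit Defensive.

(* A Groetzsch graph in G has vertices o, P_k, Q_k (k modulo 5) with edges o P_k,
   P_k Q_(k+1), P_k Q_(k-1), Q_k Q_(k+1).  The trace of a vertex x is the set of its
   neighbours in that copy.  Only 41 of the 103 independent traces are possible, and
   many pairs of traces cannot occur together: both follow from a finite search which
   alternates maximality (nonadjacent vertices have a common neighbour), property D
   (some vertex sees m + 1 of 3m given ones) and the facts found before.  Hence, after a
   rotation of the copy, every vertex has one of eleven types: those of the eight vertices
   a, b, c, u, v, w, x, y of the Vega graph, and the three letters A, B, C of the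
   vertices of the Andrasfai graph.  Types determine adjacency except between letters.

   There, orient every edge from A to B, B to C, C to A.  Six vertices on a closed
   oriented walk together with a, b, c, u, v, w contradict property D for m = 4.
   Hence every walk shortens to at most three steps, there are no closed walks, and the
   length rk of the longest walk ending at a vertex satisfies: p and q of consecutive
   letters are adjacent iff rk p < rk q.  The ranks with their letters read ABCABC...,
   property D for m = 2 forbids a number of ranks divisible by 3, and what is left
   are the Andrasfai graph and the Andrasfai graph without the vertex 2i - 1. *)

(** * Common neighbours and weighted form of property D *)

(** Property D for m = 1, applied to the constant sequence x, x, x. *)
Lemma has_neighbour (T : finType) (e : rel T) (k : nat) (x : T) :
  0 < k -> property_D k e -> exists y, e x y.
Proof.
move=> k0 D; have [y] := D 1 (introT andP (conj isT k0)) (fun=> x).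
rewrite cardE; case: (enum _) (mem_enum [in [set i : 'I_(3 * 1) | e x y]]) => // i s.
by move/(_ i); rewrite mem_head inE => /esym xy _; exists y.
Qed.

(** Maximality handles distinct vertices. The case x = y is included, where any neighbour will do,
    so that no distinctness has to be checked later. *)
Lemma common_neighbour (T : finType) (e : rel T) (k : nat) (x y : T) :
  simple_graph e -> maximal_triangle_free e -> 0 < k -> property_D k e ->
  e x y = false -> exists z, e x z && e y z.
Proof.
move=> [sym _] [_ mx] k0 D xy; have [<-|neq] := eqVneq x y.
  by have [z xz] := has_neighbour x k0 D; exists z; rewrite xz.
by have [z /andP[xz zy]] := mx x y neq (negbT xy); exists z; rewrite xz sym.
Qed.

Lemma property_D_count (T : finType) (e : rel T) (k m : nat) (s : seq T) :
  property_D k e -> 0 < m <= k -> size s = 3 * m ->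
  exists y, m < count (e^~ y) s.
Proof.
move=> D mk sz; have x0 : T by case: s sz mk => [|x s _ _]; [case: m | exact: x].
have [y lt_m] := D m mk (fun i => nth x0 s i); exists y; move: lt_m.
rewrite cardsE cardE /enum_mem size_filter.
rewrite -[in X in _ -> X](mkseq_nth x0 s) sz /mkseq -val_enum_ord -map_comp count_map.
by rewrite enumT.
Qed.

Lemma count_nseqs (T : Type) (P : pred T) (w : seq nat) (s : seq T) :
  size s = size w ->
  count P (flatten [seq nseq p.1 p.2 | p <- zip w s]) = sumn (mask (map P s) w).
Proof.
elim: s w => [|x s IHs] [|c w] //= [sz].
by rewrite count_cat count_nseq IHs //; case: (P x); rewrite ?mul1n ?mul0n.
Qed.

(** A sequence with repetitions is the same as vertices with multiplicities [w], the form in which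
    the certificate applies property D. *)
Lemma property_D_weight (T : finType) (e : rel T) (k m : nat) (w : seq nat)
    (s : seq T) :
  property_D k e -> 0 < m <= k -> size s = size w -> sumn w = 3 * m ->
  exists y, m < sumn (mask (map (e^~ y) s) w).
Proof.
move=> D mk sz sw; pose l := flatten [seq nseq p.1 p.2 | p <- zip w s].
have szl : size l = 3 * m.
  rewrite -sw -[in RHS](@unzip1_zip _ _ w s) ?sz // size_flatten /shape -map_comp.
  by congr sumn; apply: eq_map => p /=; rewrite size_nseq.
by have [y] := property_D_count D mk szl; rewrite count_nseqs //; exists y.
Qed.

(** * A checker for finite searches around a Groetzsch graph *)

(* 0 is o, 1 + k is P_k, 6 + k is Q_k. *)
Definition groetzsch_nbrs : seq (seq nat) :=
  [:: [:: 1; 2; 3; 4; 5];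
      [:: 0; 7; 10]; [:: 0; 6; 8]; [:: 0; 7; 9]; [:: 0; 8; 10]; [:: 0; 6; 9];
      [:: 2; 5; 7; 10]; [:: 1; 3; 6; 8]; [:: 2; 4; 7; 9]; [:: 3; 5; 8; 10];
      [:: 1; 4; 6; 9]].

Definition groetzsch (u v : nat) : bool := v \in nth [::] groetzsch_nbrs u.

Definition indicator (X : seq nat) : bitseq := [seq v \in X | v <- iota 0 11].

(* A possible trace, its number n, and two rows: bit n' of the first (second) row is
   false when a vertex with this trace is known not to be adjacent (not to be
   nonadjacent) to a vertex with trace number n'. *)
Definition entry := (bitseq * nat * (bitseq * bitseq))%type.
Definition etrace (en : entry) := en.1.1.
Definition eid (en : entry) := en.1.2.
Definition erow (b : bool) (en : entry) := if b then en.2.1 else en.2.2.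

Definition compatible (b : bool) (en en' : entry) := nth false (erow b en) (eid en').

(* A configuration of vertices z_0, z_1, ... outside the Groetzsch graph: the traces
   still possible for each z_i, and the triples (i, j, e z_i z_j) known so far. *)
Record state := State { cands : seq (seq entry); known : seq (nat * nat * bool) }.
Definition cand st i := nth [::] (cands st) i.
Definition knows st b i j := ((i, j, b) \in known st) || ((j, i, b) \in known st).
(** Such a pair is nonadjacent by triangle-freeness. Only the outer vertices z_k are searched:
    common neighbours inside the Groetzsch copy already show up as overlapping traces. *)
Definition linked st i j :=
  has (fun k => knows st true i k && knows st true j k) (iota 0 (size (cands st))).
Definition possible st b i j :=
  has (fun en => has (compatible b en) (cand st j)) (cand st i).

Definition infer st (p : nat * nat) :=
  let: (i, j) := p in
  if knows st true i j || knows st false i j then st else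
  if ~~ possible st true i j || linked st i j
  then State (cands st) ((i, j, false) :: known st) else
  if possible st false i j then st
  else State (cands st) ((i, j, true) :: known st).

Definition narrow st i (a : pred entry) :=
  State (set_nth [::] (cands st) i (filter a (cand st i))) (known st).

Definition restrict st (p : nat * nat * bool) :=
  let: (i, j, b) := p in
  narrow st i (fun en => has (compatible b en) (cand st j)).

Definition round st :=
  let n := size (cands st) in
  let st := foldl infer st [seq (i, j) | i <- iota 0 n, j <- iota 0 i] in
  foldl restrict st (known st ++ [seq (p.1.2, p.1.1, p.2) | p <- known st]).

(** Every round draws only valid consequences, so the number three concerns the strength of the
    search and not its soundness. *)
Definition propagate := iter 3 round.

Definition contradictory st :=
  has (fun c => nilp c) (cands st)
  || has (fun p : nat * nat * bool => p.2 && linked st p.1.1 p.1.2) (known st).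

(* Adds a vertex adjacent to all of X, where v < 11 is a vertex of the Groetzsch graph
   and 11 + i stands for z_i. *)
Definition extend (tab : seq entry) st (X : seq nat) :=
  State
    (rcons (cands st)
       [seq en <- tab | all (fun v => (11 <= v) || nth false (etrace en) v) X])
    ([seq (size (cands st), v - 11, true) | v <- X & 11 <= v] ++ known st).

Definition nonadjacent st u v :=
  if u < 11
  then [&& 11 <= v, v - 11 < size (cands st)
         & all (fun en => ~~ nth false (etrace en) u) (cand st (v - 11))]
  else (11 <= v) && knows st false (u - 11) (v - 11).

(* Common: a common neighbour of two nonadjacent vertices.  Among wb we kids: the weights
   (wb on the Groetzsch graph, we on the z_i) have sum 3m, and any vertex seeing weight
   more than m is adjacent to all of X for one of the children (X, t).
   Cases: distinguishes the trace of one z_i. *)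
Inductive tree :=
  | Absurd
  | Common of nat & nat & tree
  | Among of seq nat & seq nat & seq (seq nat * tree)
  | Cases of nat & seq (seq nat * tree).

(* Conditionals instead of connectives, which vm_compute would evaluate eagerly.
   J lists the z_k, k < i, that the vertex with trace en is assumed to see. *)
Fixpoint dominated st m (kids : seq (seq nat)) en i (cs : seq (seq entry)) ws J wt :=
  if wt + sumn ws <= m then true else
  match cs, ws with
  | c :: cs', w :: ws' =>
    (if ~~ has (compatible true en) c || has (knows st true i) J then true
     else dominated st m kids en i.+1 cs' ws' (i :: J) (wt + w))
    && (if has (compatible false en) c
        then dominated st m kids en i.+1 cs' ws' J wt else true)
  | _, _ =>
    has (all (fun v => if v < 11 then nth false (etrace en) v else v - 11 \in J)) kids
  end.

(** The tree is a proof to be replayed. Every node propagates first, so that only the genuine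
    choices have to be stored. *)
Fixpoint check (tab : seq entry) (t : tree) (st : state) : bool :=
  let st := propagate st in
  match t with
  | Absurd => contradictory st
  | Common u v t' => nonadjacent st u v && check tab t' (extend tab st [:: u; v])
  | Among wb we kids =>
    let m := sumn (wb ++ we) %/ 3 in
    [&& 0 < m <= 4, sumn (wb ++ we) == 3 * m, size wb == 11,
        size we == size (cands st),
        all (fun en => dominated st m (unzip1 kids) en 0 (cands st) we [::]
                         (sumn (mask (etrace en) wb))) tab
      & all (fun k => check tab k.2 (extend tab st k.1)) kids]
  | Cases i kids =>
    [&& i < size (cands st),
        all (fun en => has (fun k => indicator k.1 == etrace en) kids) (cand st i)
      & all (fun k => check tab k.2
                        (narrow st i (fun en => indicator k.1 == etrace en))) kids]
  end.

(** [tree] is nested through lists, so the induction hypotheses for the subtrees form a conjunction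
    folded over the list of kids. *)
Definition tree_nested_ind (P : tree -> Prop) (H0 : P Absurd)
    (H1 : forall u v t, P t -> P (Common u v t))
    (H2 : forall wb we ks, foldr (fun k Q => P k.2 /\ Q) True ks -> P (Among wb we ks))
    (H3 : forall i ks, foldr (fun k Q => P k.2 /\ Q) True ks -> P (Cases i ks)) :=
  fix F t : P t :=
    let G := fix G (ks : seq (seq nat * tree)) : foldr (fun k Q => P k.2 /\ Q) True ks :=
      match ks with [::] => I | k :: ks' => conj (F k.2) (G ks') end in
    match t with
    | Absurd => H0
    | Common u v t' => H1 u v t' (F t')
    | Among wb we ks => H2 wb we ks (G ks)
    | Cases i ks => H3 i ks (G ks)
    end.

Lemma foldr_and_has (A : Type) (Q : A -> Prop) (a b : pred A) s :
  foldr (fun k R => Q k /\ R) True s -> all a s -> has b s ->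
  exists k, [/\ Q k, a k & b k].
Proof.
elim: s => //= k s IH [Qk Qs] /andP[ak as_] /orP[bk|]; last exact: IH.
by exists k.
Qed.

(** * Soundness of the checker *)

Section Soundness.

Variables (T : finType) (e : rel T).
Hypotheses (e_simple : simple_graph e) (e_max : maximal_triangle_free e).
Hypothesis e_D : property_D 4 e.

Let e_sym : symmetric e := proj1 e_simple.
Let e_tf : triangle_free e := proj1 e_max.

Definition embedding (f : nat -> T) :=
  forall u v, u < 11 -> v < 11 -> e (f u) (f v) = groetzsch u v.

Definition trace (f : nat -> T) (x : T) : bitseq := [seq e (f v) x | v <- iota 0 11].

(** Quantifying over all Groetzsch copies [f] allows a fact about one pattern of traces to be moved
    to its images under the symmetries. Numbers must determine traces because rows refer to entries
    by number only. *)
Definition valid (tab : seq entry) :=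
  [/\ {in tab &, forall en en', eid en = eid en' -> etrace en = etrace en'},
      forall f, embedding f -> forall x, exists2 en, en \in tab & etrace en = trace f x
    & forall f, embedding f -> forall x y, {in tab &, forall en en',
        etrace en = trace f x -> etrace en' = trace f y -> compatible (e x y) en en'}].

(** The chosen entry has to lie in [tab] as well, since validity speaks only of entries of the
    table. *)
Definition realizes f (tab : seq entry) st (z : nat -> T) :=
  (forall i, i < size (cands st) ->
     exists2 en, (en \in cand st i) && (en \in tab) & etrace en = trace f (z i)) /\
  (forall i j b, (i, j, b) \in known st ->
     [&& i < size (cands st), j < size (cands st) & e (z i) (z j) == b]).

Lemma nth_trace f x v : v < 11 -> nth false (trace f x) v = e (f v) x.
Proof. by move=> lt_v; rewrite (nth_map 0) ?size_iota // nth_iota. Qed.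

Lemma triangleF x y z : e x y -> e x z -> e y z -> False.
Proof. by move=> xy xz yz; have /negP := @e_tf x y z; rewrite xy yz xz. Qed.

Section State.

Variables (f : nat -> T) (tab : seq entry).
Hypotheses (f_emb : embedding f) (tab_valid : valid tab).

Lemma realizes_knows st z b i j :
  realizes f tab st z -> knows st b i j ->
  [&& i < size (cands st), j < size (cands st) & e (z i) (z j) == b].
Proof.
move=> [_ Hk] /orP[/Hk//|/Hk/and3P[-> ->]].
by rewrite e_sym.
Qed.

Lemma realizes_linked st z i j :
  realizes f tab st z -> linked st i j -> e (z i) (z j) = false.
Proof.
move=> R /hasP[k _ /andP[/(realizes_knows R)/and3P[_ _ /eqP ik]]].
move=> /(realizes_knows R)/and3P[_ _ /eqP jk].
apply/negP => ij; apply: (@triangleF (z i) (z j) (z k)) => //.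
Qed.

Lemma realizes_possible st z i j :
  realizes f tab st z -> i < size (cands st) -> j < size (cands st) ->
  possible st (e (z i) (z j)) i j.
Proof.
move=> [Hc _] /Hc[en /andP[ci ti] tri] /Hc[en' /andP[cj tj] trj].
apply/hasP; exists en => //; apply/hasP; exists en' => //.
by have [_ _ H] := tab_valid; apply: (H f).
Qed.

Lemma realizes_infer st z p :
  realizes f tab st z -> p.1 < size (cands st) -> p.2 < size (cands st) ->
  realizes f tab (infer st p) z.
Proof.
case: p => i j R /= lti ltj; rewrite /infer.
case: ifP => // _; have Hp := realizes_possible R lti ltj.
have add b : e (z i) (z j) = b ->
    realizes f tab (State (cands st) ((i, j, b) :: known st)) z.
  case: R => Hc Hk ijb; split=> // i' j' b'; rewrite inE => /orP[/eqP[-> -> ->]|/Hk//].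
  by rewrite lti ltj ijb /=.
case: ifP => [/orP[npos|lnk]|_].
- by apply: add; apply/negP => ij; move: Hp npos; rewrite ij => ->.
- by apply: add; apply: realizes_linked R lnk.
case: ifP => // npos; apply: add; apply/negP => /negP nij.
by move: Hp; rewrite (negbTE nij) npos.
Qed.

(** Filtering is harmless as soon as the entries carrying the actual trace of z_i survive. *)
Lemma realizes_narrow st z i (a : pred entry) :
  realizes f tab st z -> i < size (cands st) ->
  (forall en, en \in cand st i -> en \in tab -> etrace en = trace f (z i) -> a en) ->
  realizes f tab (narrow st i a) z.
Proof.
move=> [Hc Hk] lti Ha; have sz : size (cands (narrow st i a)) = size (cands st).
  by rewrite /= size_set_nth; apply/maxn_idPr.
split=> [k|k j b]; rewrite sz; last by move=> /Hk.
move=> ltk; have [en /andP[ck tk] trk] := Hc k ltk; exists en => //; rewrite tk andbT.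
rewrite /cand /= nth_set_nth /=; case: eqP => // eki.
by move: ck trk; rewrite eki mem_filter => ck trk; rewrite ck andbT Ha.
Qed.

Lemma realizes_restrict st z p :
  realizes f tab st z ->
  [&& p.1.1 < size (cands st), p.1.2 < size (cands st) & e (z p.1.1) (z p.1.2) == p.2] ->
  realizes f tab (restrict st p) z.
Proof.
case: p => [[i j] b] R /= /and3P[lti ltj /eqP ijb]; apply: realizes_narrow => // en _ ten tren.
have [Hc _] := R; have [en' /andP[cj tj] trj] := Hc j ltj.
apply/hasP; exists en' => //; have [_ _ H] := tab_valid.
by rewrite -ijb; apply: (H f).
Qed.

Lemma size_infer st p : size (cands (infer st p)) = size (cands st).
Proof. by case: p => i j; rewrite /infer; do 3?case: ifP. Qed.

Lemma size_restrict st p :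
  p.1.1 < size (cands st) -> size (cands (restrict st p)) = size (cands st).
Proof. by case: p => [[i j] b] /= lti; rewrite size_set_nth; apply/maxn_idPr. Qed.

Lemma realizes_infers st z ps :
  realizes f tab st z ->
  all (fun p => (p.1 < size (cands st)) && (p.2 < size (cands st))) ps ->
  realizes f tab (foldl infer st ps) z.
Proof.
elim: ps st => //= p ps IH st R /andP[/andP[l1 l2] Hps].
apply: IH; first exact: realizes_infer.
by apply: sub_all Hps => q; rewrite size_infer.
Qed.

Lemma realizes_restricts st z ps :
  realizes f tab st z ->
  all (fun p => [&& p.1.1 < size (cands st), p.1.2 < size (cands st)
                  & e (z p.1.1) (z p.1.2) == p.2]) ps ->
  realizes f tab (foldl restrict st ps) z.
Proof.
elim: ps st => //= p ps IH st R /andP[Hp Hps]; have /and3P[lt1 _ _] := Hp.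
apply: IH; first exact: realizes_restrict.
by apply: sub_all Hps => q; rewrite size_restrict.
Qed.

Lemma realizes_round st z : realizes f tab st z -> realizes f tab (round st) z.
Proof.
move=> R; apply: realizes_restricts.
  apply: realizes_infers => //; apply/allP => _ /allpairsPdep[i [j [+ + ->]]] /=.
  by rewrite !mem_iota /= !add0n => lti ltj; rewrite lti (ltn_trans ltj lti).
set st' := foldl _ _ _; have [_ Hk] : realizes f tab st' z.
  apply: realizes_infers => //; apply/allP => _ /allpairsPdep[i [j [+ + ->]]] /=.
  by rewrite !mem_iota /= !add0n => lti ltj; rewrite lti (ltn_trans ltj lti).
rewrite all_cat; apply/andP; split; apply/allP; first by move=> [[i j] b] /Hk.
by move=> _ /mapP[[[i j] b] /Hk/and3P[lti ltj ijb] ->]; rewrite /= lti ltj e_sym.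
Qed.

Lemma realizes_propagate st z : realizes f tab st z -> realizes f tab (propagate st) z.
Proof. by move=> R; do 3!apply: realizes_round. Qed.

Lemma contradictoryP st z : realizes f tab st z -> contradictory st -> False.
Proof.
move=> R /orP[/(has_nthP [::])[i lti] |/hasP[[[i j] b] kij /= /andP[bt lnk]]].
  by have [Hc _] := R; have [en /andP[]] := Hc i lti; rewrite /cand; case: nth.
have [_ Hk] := R; have /and3P[_ _ /eqP] := Hk _ _ _ kij.
by rewrite (realizes_linked R lnk) => /esym b0; rewrite b0 in bt.
Qed.

Definition vertex (z : nat -> T) v := if v < 11 then f v else z (v - 11).

Lemma realizes_extend st z X y :
  realizes f tab st z -> all (fun v => v < 11 + size (cands st)) X ->
  all (fun v => e (vertex z v) y) X ->
  realizes f tab (extend tab st X) (fun i => if i == size (cands st) then y else z i).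
Proof.
move=> [Hc Hk] /allP X_lt /allP X_adj; set n := size (cands st).
have sz : size (cands (extend tab st X)) = n.+1 by rewrite size_rcons.
have z'E i : i < n -> (if i == n then y else z i) = z i by case: ltngtP.
split=> [i|i j b]; rewrite sz; last first.
  rewrite mem_cat => /orP[/mapP[v] |/Hk/and3P[lti ltj ijb]]; last first.
    by rewrite !z'E // ijb !ltnS (ltnW lti) (ltnW ltj).
  rewrite mem_filter => /andP[le_v vX] [-> -> ->]; rewrite ltnSn eqxx.
  have /= lt_v := X_lt v vX; have /= := X_adj v vX; rewrite /vertex ltnNge le_v /=.
  have lt_vn : v - 11 < n by rewrite ltn_subLR.
  by rewrite ltnS (ltnW lt_vn) z'E // e_sym => ->.
rewrite ltnS leq_eqVlt /cand /= nth_rcons => /orP[/eqP->|lti]; last first.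
  by rewrite lti z'E //; apply: Hc.
rewrite ltnn !eqxx; have [_ H _] := tab_valid.
have [en ten tren] := H f f_emb y; exists en => //; rewrite mem_filter ten !andbT /=.
apply/allP => v vX; have := X_adj v vX; rewrite /vertex; case: ltnP => //= lt_v.
by rewrite tren nth_trace.
Qed.

Lemma nonadjacentP st z u v :
  realizes f tab st z -> nonadjacent st u v ->
  [/\ e (vertex z u) (vertex z v) = false, u < 11 + size (cands st)
    & v < 11 + size (cands st)].
Proof.
move=> R; rewrite /nonadjacent /vertex; case: ltnP => [lt_u|le_u].
  move=> /and3P[le_v lt_v /allP Ha]; rewrite ltnNge le_v /=.
  have [Hc _] := R; have [en /andP[cen _] tren] := Hc _ lt_v.
  split; [|exact: ltn_addr|by rewrite -ltn_subLR].
  by rewrite -nth_trace // -tren; apply/negbTE/Ha.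
move=> /andP[le_v /(realizes_knows R)/and3P[ltu ltv /eqP uv]].
by rewrite ltnNge le_v /= uv -!ltn_subLR.
Qed.

(** The induction follows the branch that records which z_k are really seen by [y]: there [J] lists
    neighbours of [y] and [wt] is the weight seen so far. This branch cannot be closed by the weight
    bound, so it ends at a child all of whose vertices are seen. *)
Lemma dominatedP st z m kids en y :
  realizes f tab st z -> en \in tab -> etrace en = trace f y ->
  forall cs ws i J wt,
  cs = drop i (cands st) -> size ws = size cs ->
  {in J, forall k, k < size (cands st) /\ e (z k) y} ->
  dominated st m kids en i cs ws J wt ->
  m < wt + sumn (mask [seq e (z k) y | k <- iota i (size cs)] ws) ->
  exists2 X, X \in kids & all (fun v => (v < 11 + size (cands st)) && e (vertex z v) y) X.
Proof.
move=> R ten tren; elim=> [|c cs IH] [|w ws] //= i J wt Ecs Esz HJ.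
  rewrite !addn0; case: ifP => [le_m _|_ /hasP[X Xk /allP HX] _]; first by rewrite ltnNge le_m.
  exists X => //;   apply/allP => v vX; have := HX v vX; rewrite /vertex; case: ltnP => lt_v.
    by rewrite tren nth_trace // => ->; rewrite andbT ltn_addr.
  by move=> /HJ[lt_vn ->]; rewrite andbT -ltn_subLR.
case: ifP => [le_m _|_].
  (* The weight still to come is at most the sum of the remaining weights, so the total could not
     exceed [m]. *)
  move=> lt_m; suff : sumn (mask [seq e (z k) y | k <- iota i.+1 (size cs)] ws) <= sumn ws.
    by move: lt_m; case: (e (z i) y) => /=; lia.
  elim: ws [seq _ | k <- _] {Esz le_m lt_m} => [|u us IHu] [|[] bs] //=.
    by rewrite leq_add2l IHu.
  exact: leq_trans (IHu _) (leq_addl _ _).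
have lt_i : i < size (cands st).
  by have := congr1 size Ecs; rewrite size_drop /=; lia.
have Ecs' : cs = drop i.+1 (cands st).
  by rewrite -addn1 addnC -drop_drop -Ecs /= drop0.
have Ec : c = cand st i by rewrite /cand -[i in RHS]addn0 -nth_drop -Ecs.
case: Esz => Esz; have [_ _ V] := tab_valid; have [Hc _] := R.
have [en' /andP[ci ti] tri] := Hc i lt_i.
have := V f f_emb y (z i) en en' ten ti tren tri; rewrite e_sym => cmp.
have hc : has (compatible (e (z i) y) en) c by apply/hasP; exists en'; rewrite // Ec.
case iy : (e (z i) y) hc => hc /andP[D1 D2] /= lt_m.
  (* If [y] saw z_i and also some z_k known to be adjacent to z_i, there would be a triangle. *)
  move: D1; rewrite hc /=; case: ifP => [/hasP[k kJ kn] _|_ D1].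
    have [ltk ky] := HJ k kJ; have /and3P[_ _ /eqP ik] := realizes_knows R kn.
    by case: (@triangleF (z i) (z k) y).
  apply: IH Ecs' Esz _ D1 _; last by rewrite -addnA.
  by move=> k; rewrite inE => /orP[/eqP->|/HJ].
by move: D2; rewrite hc => D2; apply: IH Ecs' Esz HJ D2 _.
Qed.

Lemma map_vertex z n :
  map (vertex z) (iota 0 (11 + n)) = [seq f v | v <- iota 0 11] ++ [seq z i | i <- iota 0 n].
Proof.
rewrite iotaD map_cat; congr cat.
rewrite -[0 + 11]/(11 + 0) iotaDl -map_comp; apply: eq_map => i /=.
by rewrite /vertex ltnNge leq_addr addKn.
Qed.

(** Each node is a true inference: [Common] rests on maximality, [Among] on property D, [Cases] on
    the list of candidates being exhaustive. So a checked tree refutes its state. *)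
Lemma check_sound t st z : check tab t st -> realizes f tab st z -> False.
Proof.
elim/tree_nested_ind: t st z => [|u v t IH|wb we ks IH|i ks IH] st z C.
- by move=> /realizes_propagate R; apply: contradictoryP R C.
- move=> /realizes_propagate; move: C; rewrite [check _ _ _]/check -/check.
  move: (propagate st) => st' /andP[na Ct] R; have [uv ltu ltv] := nonadjacentP R na.
  have [y /andP[uy vy]] := common_neighbour e_simple e_max (isT : 0 < 4) e_D uv.
  by apply: (IH _ _ Ct); apply: (realizes_extend (y := y) R); rewrite /= ?ltu ?ltv ?uy ?vy.
- move=> /realizes_propagate ; move: C; rewrite [check _ _ _]/check -/check.
  move: (propagate st) => st'; set m := _ %/ 3.
  move=> /and5P[m4 /eqP sw /eqP szb /eqP sze /andP[Hdom Hkids]] R.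
  have szv : size (map (vertex z) (iota 0 (11 + size (cands st')))) = size (wb ++ we).
    by rewrite size_map size_iota size_cat szb sze.
  have [y] := property_D_weight e_D m4 szv sw.
  rewrite map_vertex map_cat mask_cat ?size_map ?size_iota ?szb // sumn_cat -!map_comp.
  have [_ Htab _] := tab_valid; have [en ten tren] := Htab f f_emb y.
  rewrite -[[seq _ | i <- iota 0 11]]/(trace f y) -tren => lt_m.
  have /allP/(_ en ten) dom := Hdom.
  have [|X Xks /allP HX] := dominatedP R ten tren (esym (drop0 _)) sze _ dom lt_m; first by [].
  have Xk : has (fun k => k.1 == X) ks by rewrite -(has_map fst (pred1 X)) has_pred1.
  have [k [IHk Ck /eqP kX]] := foldr_and_has IH Hkids Xk.
  apply: (IHk _ _ Ck); apply: (realizes_extend (y := y) R); rewrite kX.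
    by apply/allP => v /HX/andP[].
  by apply/allP => v /HX/andP[].
- move=> /realizes_propagate ; move: C; rewrite [check _ _ _]/check -/check.
  move: (propagate st) => st' /and3P[lti /allP Hc Hkids] R.
  have [Hr _] := R; have [en /andP[cen ten] tren] := Hr i lti.
  have [k [IHk Ck /eqP kX]] := foldr_and_has IH Hkids (Hc en cen).
  apply: (IHk _ z Ck); apply: (realizes_narrow R) => // en' _ _ tren'.
  by rewrite kX tren tren'.
Qed.

End State.
End Soundness.

(** * Tables of facts, closed under the dihedral symmetries *)

(* k |-> k + r and k |-> r - k on the indices of the P_k and Q_k *)
Definition symmetries : seq (seq nat) :=
  [seq 0 :: [seq 1 + s r k | k <- iota 0 5] ++ [seq 6 + s r k | k <- iota 0 5]
     | s <- [:: fun r k => (k + r) %% 5; fun r k => (4 * k + r) %% 5], r <- iota 0 5].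

Definition permute (p : seq nat) (s : bitseq) : bitseq := [seq nth false s v | v <- p].

(* Dead X: no vertex has trace X.  Clash b X Y: e x y <> b whenever x has trace X
   and y has trace Y. *)
Inductive fact :=
  | Dead of seq nat & tree
  | Clash of bool & seq nat & seq nat & tree.

Definition with_trace (tab : seq entry) X := [seq en <- tab | etrace en == indicator X].

Definition verify (tab : seq entry) (ft : fact) : bool :=
  match ft with
  | Dead X t => check tab t (State [:: with_trace tab X] [::])
  | Clash b X Y t => check tab t (State [:: with_trace tab X; with_trace tab Y] [:: (1, 0, b)])
  end.

(** One and the same symmetry has to carry the two traces to [X] and [Y]. Those fitting the first
    trace are computed once, outside the loop over the table. *)
Definition partners (tab : seq entry) (en : entry) X Y : seq nat :=
  let ps := let x := indicator X in [seq p <- symmetries | permute p (etrace en) == x] in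
  if nilp ps then [::] else
  let y := indicator Y in
  [seq eid en' | en' <- tab & has (fun p => permute p (etrace en') == y) ps].

Definition erase (ks : seq nat) (r : bitseq) := foldr (fun k r => set_nth false r k false) r ks.

Definition erase_row (b : bool) ks (en : entry) : entry :=
  if b then (en.1, (erase ks en.2.1, en.2.2)) else (en.1, (en.2.1, erase ks en.2.2)).

(** A dead trace takes its whole orbit with it. The remaining entries keep their numbers, so that
    rows stay meaningful. A clash is entered in both orders because adjacency is symmetric. *)
Definition update (tab : seq entry) (ft : fact) : seq entry :=
  match ft with
  | Dead X _ =>
    let x := indicator X in
    [seq en <- tab | ~~ has (fun p => permute p (etrace en) == x) symmetries]
  | Clash b X Y _ =>
    [seq erase_row b (partners tab en X Y ++ partners tab en Y X) en | en <- tab]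
  end.

Fixpoint run (fts : seq fact) (tab : seq entry) : option (seq entry) :=
  match fts with
  | [::] => Some tab
  | ft :: fts' => if verify tab ft then run fts' (update tab ft) else None
  end.

Definition bitseqs n : seq bitseq :=
  iter n (fun l => [seq b :: s | b <- [:: true; false], s <- l]) [:: [::]].

Definition independent (s : bitseq) : bool :=
  all (fun u => ~~ nth false s u || all (fun v => ~~ nth false s v) (nth [::] groetzsch_nbrs u))
    (iota 0 11).

Definition disjoint_bits (s t : bitseq) : bool := ~~ has (fun p => p.1 && p.2) (zip s t).

(** This is what triangle-freeness alone gives: traces are independent in the copy, and adjacent
    vertices have disjoint traces. Nothing is excluded yet for nonadjacent vertices. *)
Definition initial_table : seq entry :=
  let l := [seq s <- bitseqs 11 | independent s] in
  [seq (p.1, p.2, ([seq disjoint_bits p.1 t | t <- l], [seq true | _ <- l]))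
     | p <- zip l (iota 0 (size l))].

(** * Verified facts keep the table valid *)

Section Facts.

Variables (T : finType) (e : rel T).
Hypotheses (e_simple : simple_graph e) (e_max : maximal_triangle_free e).
Hypothesis e_D : property_D 4 e.

Let e_sym : symmetric e := proj1 e_simple.
Notation embedding := (embedding e).
Notation trace := (trace e).
Notation valid := (valid e).

Lemma size_symmetry p : p \in symmetries -> size p = 11.
Proof. by move=> ps; apply/eqP; apply: (allP (a := fun p => size p == 11)) p ps. Qed.

Lemma embedding_symmetry f p :
  p \in symmetries -> embedding f -> embedding (f \o nth 0 p).
Proof.
move=> ps f_emb u v lt_u lt_v.
have /allP/(_ p ps)/andP[p_lt p_adj] : all (fun p => all (gtn 11) p &&
    all (fun u => all (fun v => groetzsch (nth 0 p u) (nth 0 p v) == groetzsch u v)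
      (iota 0 11)) (iota 0 11)) symmetries by vm_compute.
have lt_p w : w < 11 -> nth 0 p w < 11.
  by move=> lt_w; apply: (allP p_lt); rewrite mem_nth // size_symmetry.
rewrite /= f_emb ?lt_p //; apply/eqP.
by apply: (allP (allP p_adj u _)); rewrite mem_iota.
Qed.

Lemma trace_symmetry f p x :
  p \in symmetries -> trace (f \o nth 0 p) x = permute p (trace f x).
Proof.
move=> ps; apply: (@eq_from_nth _ false) => [|v]; rewrite !size_map size_iota.
  by rewrite size_symmetry.
move=> lt_v; rewrite nth_trace // (nth_map 0) ?size_symmetry // nth_trace //.
have /allP/(_ p ps)/allP p_lt : all (fun p => all (gtn 11) p) symmetries by vm_compute.
by apply: p_lt; rewrite mem_nth // size_symmetry.
Qed.

Lemma realizes_traces f tab x X :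
  valid tab -> embedding f -> trace f x = indicator X ->
  exists2 en, (en \in with_trace tab X) && (en \in tab) & etrace en = trace f x.
Proof.
move=> [_ H _] f_emb xX; have [en ten tren] := H f f_emb x; exists en => //.
by rewrite mem_filter ten tren xX eqxx.
Qed.

Lemma verify_dead tab X t f x :
  valid tab -> verify tab (Dead X t) -> embedding f -> trace f x <> indicator X.
Proof.
move=> V C f_emb xX; apply: (check_sound e_simple e_max e_D f_emb V (z := fun=> x) C).
by split=> // -[|//] _; apply: realizes_traces.
Qed.

Lemma verify_clash tab b X Y t f x y :
  valid tab -> verify tab (Clash b X Y t) -> embedding f ->
  trace f x = indicator X -> trace f y = indicator Y -> e x y <> b.
Proof.
move=> V C f_emb xX yY xy.
apply: (check_sound e_simple e_max e_D f_emb V (z := nth x [:: x; y]) C).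
split=> [[|[|//]] _|i j c]; [exact: realizes_traces..|].
by rewrite inE => /eqP[-> -> ->] /=; rewrite e_sym xy eqxx.
Qed.

Lemma nth_erase ks r k : nth false (erase ks r) k = (k \notin ks) && nth false r k.
Proof.
elim: ks => //= i ks IH; rewrite nth_set_nth /= inE negb_or IH.
by case: eqP.
Qed.

Lemma etrace_erase_row b ks en : etrace (erase_row b ks en) = etrace en.
Proof. by case: b. Qed.

Lemma eid_erase_row b ks en : eid (erase_row b ks en) = eid en.
Proof. by case: b. Qed.

Lemma compatible_erase_row b c ks ks' en en' :
  compatible c (erase_row b ks en) (erase_row b ks' en') =
  ~~ ((b == c) && (eid en' \in ks)) && compatible c en en'.
Proof. by rewrite /compatible eid_erase_row; case: b; case: c => //=; rewrite nth_erase. Qed.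

Lemma partnersP tab en k X Y :
  k \in partners tab en X Y ->
  exists p en', [/\ p \in symmetries, en' \in tab, k = eid en',
    permute p (etrace en) = indicator X & permute p (etrace en') = indicator Y].
Proof.
rewrite /partners; case: ifP => // _ /mapP[en']; rewrite mem_filter.
move=> /andP[/hasP[p]]; rewrite mem_filter => /andP[/eqP pX ps] /eqP pY ten' ->.
by exists p, en'.
Qed.

(** Vertices contradicting the updated table for the copy [f] would show exactly the excluded traces
    with respect to the copy composed with the symmetry. *)
Lemma update_valid tab ft : valid tab -> verify tab ft -> valid (update tab ft).
Proof.
move=> V C; have [Vid Vtr Vco] := V; case: ft C => [X t|b X Y t] C.
  have sub en : en \in update tab (Dead X t) -> en \in tab.
    by rewrite mem_filter => /andP[].
  split=> [en en' /sub ten /sub|f f_emb x|f f_emb x y en en' /sub ten /sub ten'].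
  - exact: Vid.
  - have [en ten tren] := Vtr f f_emb x; exists en => //; rewrite mem_filter ten andbT.
    apply/hasPn => p ps; apply/eqP; rewrite tren -trace_symmetry //.
    exact/(verify_dead V C)/embedding_symmetry.
  - exact: Vco.
have noclash f x y en en' : embedding f -> en \in tab -> en' \in tab ->
    etrace en = trace f x -> etrace en' = trace f y -> b == e x y ->
    eid en' \in partners tab en X Y ++ partners tab en Y X -> False.
  move=> f_emb ten ten' tren tren' /eqP bxy; rewrite mem_cat => /orP[] /partnersP.
    move=> [p [en'' [ps ten'' Eid pX pY]]].
    (* Equal numbers mean equal traces, so the trace of [en''] may be replaced by that of [en']. *)
    have E := Vid _ _ ten' ten'' Eid; move: pX pY; rewrite -E tren tren'.
    rewrite -!trace_symmetry // => pX pY.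
    by apply: (verify_clash V C (embedding_symmetry ps f_emb) pX pY).
  move=> [p [en'' [ps ten'' Eid pY pX]]].
  have E := Vid _ _ ten' ten'' Eid; move: pX pY; rewrite -E tren tren'.
  rewrite -!trace_symmetry // => pX pY.
  by apply: (verify_clash V C (embedding_symmetry ps f_emb) pX pY); rewrite e_sym.
split=> [_ _ /mapP[en ten ->] /mapP[en' ten' ->]|f f_emb x|].
- by rewrite !etrace_erase_row !eid_erase_row; apply: Vid.
- have [en ten tren] := Vtr f f_emb x; eexists; first exact: map_f ten.
  by rewrite etrace_erase_row.
move=> f f_emb x y _ _ /mapP[en ten ->] /mapP[en' ten' ->].
rewrite !etrace_erase_row compatible_erase_row => tren tren'.
rewrite (Vco f) // andbT; apply/negP => /andP[bxy].
exact: noclash f_emb ten ten' tren tren' bxy.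
Qed.

Lemma run_valid fts tab tab' : run fts tab = Some tab' -> valid tab -> valid tab'.
Proof.
elim: fts tab => [|ft fts IH] tab /= => [[->]//|].
by case: ifP => // C /IH H V; apply/H/update_valid.
Qed.

Lemma mem_bitseqs n s : size s = n -> s \in bitseqs n.
Proof.
elim: n s => [|n IH] [|b s] // [sz]; rewrite /bitseqs iterS; apply/allpairsPdep.
by exists b, s; split; [case: b | apply: IH |].
Qed.

Lemma trace_independent f x : embedding f -> independent (trace f x).
Proof.
move=> f_emb; apply/allP => u; rewrite mem_iota add0n => /= lt_u.
rewrite nth_trace // -implybE; apply/implyP => ux; apply/allP => v uv.
have lt_v : v < 11.
  have /allP/(_ u) : all (fun u => all (gtn 11) (nth [::] groetzsch_nbrs u)) (iota 0 11).
    by vm_compute.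
  by rewrite mem_iota add0n lt_u => /(_ isT)/allP/(_ v uv).
rewrite nth_trace //; apply/negP => vx.
by apply: (@triangleF _ _ e_max (f u) (f v) x) => //; rewrite f_emb.
Qed.

Lemma trace_disjoint f x y : e x y -> disjoint_bits (trace f x) (trace f y).
Proof.
move=> xy; apply/hasP => -[[a b]] /(nthP (false, false))[v].
rewrite size_zip !size_map !size_iota minnn => lt_v.
rewrite nth_zip ?size_map // !nth_trace // => -[<- <-] /= /andP[vx vy].
by apply: (@triangleF _ _ e_max (f v) x y).
Qed.

Lemma initial_table_valid : valid initial_table.
Proof.
rewrite /initial_table; set l := [seq s <- _ | _].
have trP f x : embedding f -> trace f x \in l.
  by move=> f_emb; rewrite mem_filter trace_independent // mem_bitseqs.
(* From here on only [trP] matters; an opaque [l] keeps the list of bit sequences from being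
   computed. *)
clearbody l.
have memP en : en \in [seq (p.1, p.2, ([seq disjoint_bits p.1 t | t <- l], [seq true | _ <- l]))
     | p <- zip l (iota 0 (size l))] -> exists2 i, i < size l &
   en = (nth [::] l i, i, ([seq disjoint_bits (nth [::] l i) t | t <- l], [seq true | _ <- l])).
  move=> /mapP[p /(nthP ([::], 0))[i]]; rewrite size_zip size_iota minnn => lti.
  by rewrite nth_zip ?size_iota // nth_iota // add0n => <- ->; exists i.
split=> [en en' /memP[i lti ->] /memP[j ltj ->]|f f_emb x|f f_emb x y en en'].
- by rewrite /eid /etrace /= => ->.
- have /(nthP [::])[i lti xi] := trP f x f_emb.
  exists (nth [::] l i, i, ([seq disjoint_bits (nth [::] l i) t | t <- l], [seq true | _ <- l])) => //.
  apply/mapP; exists (nth [::] l i, i) => //; apply/(nthP ([::], 0)); exists i.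
    by rewrite size_zip size_iota minnn.
  by rewrite nth_zip ?size_iota // nth_iota.
move=> /memP[i lti ->] /memP[j ltj ->]; rewrite /etrace /compatible /eid /=.
move=> xi yj; rewrite /erow; case xy: (e x y); last by rewrite (nth_map [::]).
by rewrite (nth_map [::]) // xi yj; apply: trace_disjoint.
Qed.

End Facts.

(** * The traces that occur *)

(* Found by a best-first search over linear programming relaxations. *)
Definition certificate : seq fact := [::
    Dead [:: 1; 2] (Common 4 11 (Among [:: 1; 1; 1; 1; 1; 0; 1; 1; 1; 1; 1] [:: 1; 1] [:: ([::
      1; 3; 6; 8; 12], Among [:: 1; 1; 1; 0; 1; 1; 1; 0; 1; 1; 1] [:: 1; 1; 1] [::])]));
    Dead [:: 3; 4; 6] (Common 1 11 (Among [:: 1; 1; 0; 1; 1; 1; 1; 1; 1; 1; 1] [:: 1; 1] [::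
      ([:: 3; 5; 8; 10; 12], Among [:: 1; 1; 1; 1; 1; 0; 1; 1; 1; 0; 1] [:: 1; 1; 1] [::])]));
    Dead [:: 1; 2; 3] (Common 4 11 (Among [:: 1; 1; 1; 0; 1; 1; 1; 1; 1; 1; 1] [:: 1; 1] [::
      ([:: 2; 5; 7; 10; 12], Among [:: 1; 1; 1; 1; 1; 0; 0; 1; 1; 1; 1] [:: 1; 1; 1] [::])]));
    Dead [:: 1; 2; 3; 4] (Common 5 11 (Among [:: 1; 0; 1; 1; 1; 1; 1; 1; 1; 1; 1] [:: 1; 1] [::
      ([:: 2; 4; 7; 9; 12], Among [:: 1; 1; 1; 1; 0; 1; 1; 1; 0; 1; 1] [:: 1; 1; 1] [::])]));
    Dead [:: 1; 2; 4] (Common 3 11 (Among [:: 1; 1; 1; 1; 0; 1; 1; 1; 1; 1; 1] [:: 1; 1] [::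
      ([:: 3; 5; 8; 10; 11], Common 9 11 (Among [:: 1; 1; 1; 1; 0; 0; 1; 1; 1; 1; 1] [:: 1; 0;
      1; 1] [:: ([:: 1; 3; 6; 8; 14], Among [:: 1; 1; 1; 0; 0; 1; 1; 0; 1; 1; 1] [:: 1; 0; 1; 1;
      1] [::])])); ([:: 2; 5; 7; 10; 12], Among [:: 1; 1; 0; 1; 1; 1; 0; 1; 1; 1; 1] [:: 1; 1;
      1] [:: ([:: 3; 5; 8; 10; 11], Common 9 11 (Among [:: 1; 1; 1; 0; 0; 1; 1; 1; 1; 1; 1] [::
      1; 0; 0; 1; 1] [:: ([:: 2; 5; 7; 10; 15], Among [:: 1; 1; 1; 1; 0; 0; 0; 1; 1; 1; 1] [::
      1; 0; 0; 1; 1; 1] [::])]))])]));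
    Dead [:: 3; 6] (Common 1 11 (Among [:: 1; 1; 0; 1; 1; 1; 1; 1; 1; 1; 1] [:: 1; 1] [:: ([::
      3; 5; 8; 10; 12], Common 8 11 (Among [:: 0; 0; 0; 0; 0; 1; 1; 0; 1; 0; 0] [:: 1; 0; 1; 1]
      [:: ([:: 6; 13; 14], Among [:: 1; 1; 1; 1; 0; 0; 1; 1; 1; 0; 0] [:: 1; 1; 1; 1; 1] [::]);
      ([:: 5; 8; 11], Among [:: 1; 1; 1; 1; 0; 1; 1; 1; 1; 0; 0] [:: 1; 1; 1; 0; 1] [::])]))]));
    Clash false [:: 1; 2; 3; 4; 5] [:: 0; 6] (Common 11 12 (Among [:: 1; 1; 0; 0; 1; 1; 1; 1; 1;
      1; 1] [:: 1; 1; 1] [:: ([:: 1; 4; 6; 9; 13], Among [:: 1; 0; 1; 1; 1; 0; 1; 1; 1; 1; 1]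
      [:: 1; 1; 1; 0] [:: ([:: 2; 4; 7; 9; 12], Among [:: 1; 0; 0; 1; 1; 1; 1; 1; 0; 1; 0] [::
      1; 1; 1; 1; 1] [::]); ([:: 2; 4; 7; 9; 13], Among [:: 1; 1; 1; 1; 0; 0; 1; 1; 0; 1; 1] [::
      1; 1; 1; 0; 1] [::])])]));
    Clash false [:: 1; 2; 3; 4; 5] [:: 0; 6; 8] (Common 11 12 (Among [:: 1; 0; 0; 1; 1; 1; 1; 1;
      1; 1; 1] [:: 1; 1; 1] [:: ([:: 3; 5; 8; 10; 13], Among [:: 1; 1; 0; 0; 1; 1; 1; 1; 1; 0;
      1] [:: 1; 1; 1; 1] [::])]));
    Clash false [:: 0; 6] [:: 2; 4; 5; 7] (Common 11 12 (Among [:: 1; 1; 0; 0; 1; 1; 1; 1; 1; 1;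
      1] [:: 1; 1; 1] [:: ([:: 1; 4; 6; 9; 13], Common 9 11 (Among [:: 1; 0; 0; 1; 1; 1; 1; 1;
      0; 1; 0] [:: 1; 1; 1; 1; 1] [:: ([:: 4; 5; 7; 13; 15], Among [:: 1; 1; 0; 0; 1; 1; 1; 1;
      1; 1; 1] [:: 1; 0; 0; 0; 1; 1] [::]); ([:: 3; 4; 6; 13; 15], Among [:: 1; 0; 0; 1; 1; 1;
      1; 1; 1; 1; 0] [:: 1; 1; 1; 0; 0; 1] [::])]))]));
    Clash true [:: 1; 3; 6] [:: 2; 4; 5; 7] (Common 8 11 (Among [:: 1; 0; 0; 1; 1; 1; 1; 1; 1;
      1; 1] [:: 1; 1; 1] [:: ([:: 0; 6; 9; 12; 13], Among [:: 1; 1; 0; 1; 1; 1; 0; 1; 1; 1; 1]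
      [:: 1; 1; 1; 0] [:: ([:: 3; 4; 5; 13], Absurd)])]));
    Clash false [:: 1; 3; 6] [:: 2; 7; 10] (Common 11 12 (Common 5 12 (Among [:: 1; 0; 1; 1; 1;
      1; 1; 0; 1; 1; 1] [:: 1; 1; 0; 1] [:: ([:: 2; 4; 9; 11; 14], Among [:: 1; 0; 0; 1; 1; 1;
      1; 1; 1; 1; 1] [:: 1; 1; 1; 0; 0] [:: ([:: 3; 5; 8; 10; 13], Among [:: 1; 0; 1; 1; 1; 1;
      1; 1; 1; 0; 1] [:: 0; 1; 0; 1; 0; 1] [:: ([:: 2; 4; 7; 14; 16], Among [:: 1; 1; 1; 0; 0;
      1; 1; 0; 0; 0; 1] [:: 1; 1; 1; 1; 0; 1; 1] [::])])]); ([:: 0; 8; 10; 11; 14], Among [:: 1;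
      0; 1; 1; 0; 1; 1; 1; 1; 1; 1] [:: 0; 1; 0; 1; 1] [::])])));
    Clash false [:: 1; 3; 6] [:: 0; 7; 10] (Common 11 12 (Among [:: 1; 0; 0; 1; 1; 1; 1; 1; 1;
      1; 1] [:: 1; 1; 1] [:: ([:: 3; 5; 8; 10; 13], Common 8 11 (Among [:: 0; 0; 0; 0; 0; 1; 1;
      0; 1; 0; 0] [:: 1; 0; 0; 1; 1] [:: ([:: 6; 14; 15], Among [:: 1; 0; 1; 1; 0; 0; 1; 1; 1;
      0; 0] [:: 1; 1; 1; 1; 1; 1] [::]); ([:: 5; 8; 11], Among [:: 1; 0; 1; 1; 0; 0; 1; 1; 1; 0;
      1] [:: 1; 1; 1; 1; 0; 1] [::])]))]));
    Clash false [:: 1; 3; 4; 6] [:: 0; 7; 10] (Common 11 12 (Among [:: 1; 0; 1; 1; 1; 0; 1; 1;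
      1; 1; 1] [:: 1; 1; 1] [:: ([:: 2; 4; 7; 9; 13], Among [:: 1; 0; 0; 1; 1; 1; 1; 1; 0; 1; 1]
      [:: 1; 1; 1; 1] [::])]));
    Clash true [:: 1; 3; 4; 6] [:: 2; 7; 10] (Common 5 12 (Among [:: 1; 0; 1; 1; 1; 1; 1; 1; 1;
      1; 1] [:: 0; 1; 1] [:: ([:: 2; 4; 7; 9; 13], Among [:: 1; 0; 1; 1; 1; 1; 1; 0; 0; 1; 1]
      [:: 1; 1; 1; 1] [::])]));
    Clash false [:: 1; 3; 4; 6] [:: 2; 7; 10] (Common 11 12 (Among [:: 1; 0; 1; 1; 1; 0; 1; 1;
      1; 1; 1] [:: 1; 1; 1] [:: ([:: 2; 4; 7; 9; 13], Among [:: 1; 0; 0; 1; 1; 1; 1; 1; 0; 1; 1]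
      [:: 1; 1; 1; 1] [::])]));
    Clash false [:: 1; 3; 4; 6] [:: 2; 5; 7; 10] (Common 11 12 (Among [:: 1; 0; 1; 1; 1; 0; 1;
      1; 1; 1; 1] [:: 1; 1; 1] [:: ([:: 2; 4; 7; 9; 13], Among [:: 1; 0; 0; 1; 1; 1; 1; 1; 0; 1;
      1] [:: 1; 1; 1; 1] [::])]));
    Clash false [:: 1; 6; 8] [:: 1; 6; 9] (Common 4 12 (Among [:: 1; 1; 1; 1; 1; 0; 1; 1; 1; 1;
      1] [:: 0; 1; 1] [:: ([:: 1; 3; 6; 8; 13], Common 3 11 (Among [:: 1; 1; 0; 1; 1; 1; 0; 0;
      1; 1; 0] [:: 1; 1; 1; 1; 1] [:: ([:: 1; 3; 5; 8; 13], Among [:: 1; 1; 1; 0; 1; 1; 1; 0; 1;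
      1; 1] [:: 0; 1; 1; 0; 0; 1] [::])]))]));
    Clash false [:: 1; 6; 8] [:: 2; 7; 9] (Common 11 12 (Among [:: 1; 1; 0; 0; 1; 1; 1; 1; 1; 1;
      1] [:: 1; 1; 1] [:: ([:: 1; 4; 6; 9; 13], Common 4 12 (Among [:: 1; 1; 1; 0; 1; 1; 1; 1;
      1; 1; 0] [:: 0; 1; 0; 1; 1] [:: ([:: 2; 5; 7; 14; 15], Among [:: 1; 0; 1; 1; 1; 0; 0; 0;
      1; 1; 0] [:: 1; 1; 1; 1; 1; 1] [:: ([:: 2; 3; 11; 14; 15], Among [:: 1; 1; 1; 1; 1; 0; 0;
      1; 1; 1; 1] [:: 0; 1; 0; 0; 1; 0; 1] [::])])]))]));
    Clash false [:: 1; 6; 8] [:: 2; 7; 10] (Common 11 12 (Among [:: 1; 0; 0; 1; 1; 1; 1; 1; 1;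
      1; 1] [:: 1; 1; 1] [:: ([:: 3; 5; 8; 10; 13], Common 3 11 (Among [:: 1; 1; 0; 1; 1; 1; 1;
      1; 1; 0; 1] [:: 1; 0; 0; 1; 1] [:: ([:: 1; 4; 6; 14; 15], Among [:: 1; 1; 1; 1; 0; 0; 0;
      1; 1; 0; 0] [:: 1; 1; 1; 1; 1; 1] [::])]))]));
    Clash false [:: 1; 6; 8] [:: 2; 5; 7; 10] (Common 11 12 (Common 3 11 (Among [:: 1; 1; 0; 1;
      1; 1; 0; 1; 1; 1; 1] [:: 1; 1; 0; 1] [:: ([:: 1; 4; 9; 12; 14], Among [:: 1; 0; 0; 1; 1;
      1; 1; 1; 1; 1; 1] [:: 1; 1; 1; 0; 0] [:: ([:: 3; 5; 8; 10; 13], Among [:: 1; 1; 0; 1; 1;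
      1; 1; 1; 1; 0; 1] [:: 1; 0; 0; 1; 0; 1] [:: ([:: 1; 4; 6; 14; 16], Among [:: 1; 1; 1; 1;
      0; 0; 0; 1; 1; 0; 0] [:: 1; 1; 1; 1; 0; 1; 1] [::])])])])));
    Clash true [:: 1] [:: 2; 4; 5; 7] (Common 6 11 (Among [:: 1; 1; 0; 0; 1; 1; 1; 1; 1; 1; 1]
      [:: 1; 1; 1] [:: ([:: 0; 8; 10; 12; 13], Among [:: 1; 1; 0; 1; 1; 1; 1; 1; 0; 1; 1] [:: 1;
      1; 1; 0] [:: ([:: 3; 4; 13], Absurd)])]));
    Clash true [:: 1] [:: 6; 8] (Common 4 11 (Among [:: 1; 1; 1; 1; 1; 0; 1; 1; 1; 1; 1] [:: 1;
      0; 1] [:: ([:: 2; 4; 7; 9; 11], Among [:: 1; 1; 0; 0; 1; 1; 1; 1; 1; 1; 1] [:: 1; 1; 0; 1]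
      [::]); ([:: 1; 3; 6; 8; 13], Among [:: 1; 1; 0; 0; 1; 1; 1; 0; 1; 1; 1] [:: 1; 1; 1; 1]
      [::])]));
    Clash true [:: 1] [:: 0; 6; 8] (Common 4 11 (Among [:: 1; 1; 0; 1; 1; 0; 1; 1; 1; 1; 1] [::
      1; 1; 1] [:: ([:: 1; 3; 6; 8; 13], Among [:: 1; 1; 0; 0; 1; 1; 1; 0; 1; 1; 1] [:: 1; 1; 1;
      1] [::])]));
    Clash true [:: 1] [:: 3; 6; 8] (Among [:: 1; 1; 0; 0; 1; 1; 1; 1; 1; 0; 0] [:: 1; 1] [::]);
    Clash true [:: 1] [:: 2; 4; 7; 9] (Common 6 11 (Common 8 11 (Among [:: 0; 0; 0; 0; 0; 0; 1;
      1; 1; 0; 0] [:: 1; 0; 1; 1] [:: ([:: 7; 13; 14], Among [:: 1; 1; 0; 0; 1; 1; 1; 1; 0; 1;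
      1] [:: 1; 1; 1; 0; 1] [:: ([:: 1; 4; 6; 9; 15], Among [:: 1; 0; 0; 1; 1; 1; 1; 1; 0; 1; 0]
      [:: 1; 1; 0; 1; 1; 1] [:: ([:: 3; 5; 12; 14; 16], Among [:: 1; 1; 1; 0; 0; 1; 1; 0; 1; 1;
      0] [:: 1; 1; 0; 1; 0; 1; 1] [::])])])])));
    Clash true [:: 1] [:: 2; 5; 7; 10] (Common 6 11 (Among [:: 1; 0; 0; 1; 1; 1; 2; 1; 1; 1; 1]
      [:: 1; 0; 1] [:: ([:: 3; 5; 8; 10; 13], Among [:: 1; 0; 1; 1; 1; 0; 2; 1; 1; 1; 1] [:: 1;
      0; 1; 0] [:: ([:: 2; 4; 7; 9; 13], Among [:: 1; 0; 1; 1; 1; 0; 1; 1; 1; 0; 1] [:: 1; 1; 1;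
      1; 0] [:: ([:: 2; 4; 7; 11; 14], Among [:: 1; 1; 0; 0; 1; 1; 1; 1; 0; 1; 1] [:: 1; 0; 1;
      0; 1; 1] [::])])])]));
    Clash true [:: 1] [:: 2; 7; 10] (Common 6 11 (Among [:: 1; 0; 1; 1; 1; 0; 2; 1; 1; 1; 1] [::
      1; 0; 1] [:: ([:: 2; 4; 7; 9; 13], Among [:: 1; 0; 0; 1; 1; 1; 2; 1; 1; 1; 1] [:: 1; 0; 1;
      0] [:: ([:: 3; 5; 8; 10; 13], Among [:: 1; 1; 1; 0; 0; 1; 1; 1; 2; 1; 0] [:: 1; 0; 1; 0;
      1] [:: ([:: 0; 7; 9; 11; 15], Among [:: 1; 0; 0; 0; 1; 1; 1; 1; 0; 1; 1] [:: 1; 1; 1; 1;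
      0; 1] [::]); ([:: 1; 5; 8; 13], Absurd); ([:: 2; 7; 9; 11], Absurd)])])]));
    Clash false [:: 1] [:: 2; 5; 7; 10] (Common 11 12 (Among [:: 1; 0; 1; 1; 1; 1; 2; 1; 1; 1;
      1] [:: 1; 0; 0] [::]));
    Clash false [:: 1] [:: 2; 7; 10] (Common 11 12 (Among [:: 1; 0; 1; 1; 1; 1; 2; 1; 1; 1; 1]
      [:: 1; 0; 0] [:: ([:: 2; 5; 7; 10; 11], Among [:: 2; 0; 0; 2; 2; 0; 0; 1; 0; 0; 1] [:: 1;
      1; 1; 1] [:: ([:: 0; 7; 10; 13], Among [:: 1; 1; 1; 0; 0; 0; 0; 0; 0; 0; 0] [:: 1; 1; 1;
      0; 0] [:: ([:: 0; 11; 12], Among [:: 1; 0; 0; 1; 1; 0; 0; 1; 0; 0; 1] [:: 1; 1; 0; 1; 0;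
      1] [::]); ([:: 1; 2; 13], Among [:: 1; 1; 1; 0; 0; 1; 0; 1; 1; 1; 0] [:: 1; 0; 1; 1; 1; 1]
      [::])]); ([:: 3; 4; 13], Among [:: 1; 0; 0; 1; 1; 0; 0; 1; 0; 0; 1] [:: 1; 1; 1; 1; 0] [::
      ([:: 0; 10; 13], Absurd)])])]));
    Clash true [:: 1; 3] [:: 2; 4; 5; 7] (Common 6 11 (Among [:: 1; 1; 0; 0; 1; 1; 1; 1; 1; 1;
      1] [:: 1; 1; 1] [:: ([:: 0; 8; 10; 12; 13], Among [:: 1; 1; 0; 1; 1; 1; 1; 1; 0; 1; 1] [::
      1; 1; 1; 0] [:: ([:: 3; 4; 13], Absurd)])]));
    Clash true [:: 1; 3] [:: 6; 8] (Common 0 12 (Among [:: 1; 1; 0; 1; 1; 1; 1; 1; 1; 1; 1] [::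
      1; 1; 0] [:: ([:: 1; 3; 4; 5; 12], Among [:: 2; 0; 0; 1; 1; 1; 1; 1; 1; 1; 1] [:: 0; 1; 1;
      0] [:: ([:: 3; 5; 8; 10; 13], Among [:: 2; 1; 0; 0; 1; 1; 1; 1; 1; 0; 1] [:: 0; 1; 1; 0;
      1] [:: ([:: 0; 10; 12], Absurd); ([:: 0; 7; 12], Absurd)]); ([:: 0; 9; 12], Absurd); ([::
      0; 10; 12], Absurd)])]));
    Clash true [:: 1; 3] [:: 0; 6; 8] (Common 4 11 (Among [:: 1; 1; 0; 1; 1; 0; 1; 1; 1; 1; 1]
      [:: 1; 1; 1] [:: ([:: 1; 3; 6; 8; 13], Among [:: 1; 1; 0; 0; 1; 1; 1; 0; 1; 1; 1] [:: 1;
      1; 1; 1] [::])]));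
    Clash true [:: 1; 3] [:: 2; 4; 9] (Common 8 11 (Common 7 12 (Among [:: 1; 1; 0; 0; 1; 1; 1;
      1; 2; 1; 1] [:: 1; 0; 1; 0] [:: ([:: 1; 4; 6; 9; 13], Among [:: 1; 0; 1; 1; 0; 0; 0; 1; 0;
      0; 0] [:: 0; 1; 0; 1; 0] [:: ([:: 0; 7; 12], Among [:: 1; 0; 1; 1; 0; 0; 1; 1; 1; 1; 0]
      [:: 1; 1; 1; 0; 1; 1] [::]); ([:: 2; 3; 14], Among [:: 0; 0; 1; 1; 0; 0; 1; 1; 1; 1; 0]
      [:: 1; 1; 1; 1; 1; 1] [::])]); ([:: 5; 8; 10; 11], Among [:: 1; 1; 1; 0; 0; 1; 0; 0; 1; 1;
      0] [:: 1; 1; 0; 0; 1] [::]); ([:: 0; 8; 10; 11], Absurd)])));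
    Clash true [:: 1; 3] [:: 4; 6; 9] (Common 8 11 (Among [:: 1; 1; 1; 1; 1; 0; 1; 1; 1; 1; 1]
      [:: 1; 1; 0] [:: ([:: 2; 4; 7; 9; 11], Among [:: 1; 1; 0; 0; 1; 1; 1; 1; 1; 1; 1] [:: 1;
      0; 1; 1] [:: ([:: 1; 4; 6; 9; 13], Among [:: 1; 1; 1; 1; 0; 0; 1; 1; 1; 1; 0] [:: 1; 1; 1;
      0; 1] [::])])]));
    Clash true [:: 1; 3] [:: 4; 7; 9] (Common 2 12 (Common 8 11 (Among [:: 1; 0; 1; 1; 1; 0; 1;
      1; 1; 0; 1] [:: 1; 1; 1; 1] [:: ([:: 2; 3; 10; 12; 14], Among [:: 1; 1; 1; 0; 1; 0; 1; 1;
      1; 0; 1] [:: 1; 1; 0; 1; 1] [::])])));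
    Clash true [:: 1; 2; 3; 4; 5] [:: 6] (Common 0 12 (Among [:: 2; 1; 0; 0; 1; 1; 1; 1; 1; 1;
      1] [:: 0; 1; 1] [:: ([:: 1; 4; 6; 9; 13], Among [:: 2; 0; 1; 1; 1; 0; 1; 1; 1; 1; 1] [::
      0; 1; 1; 0] [:: ([:: 2; 4; 7; 9; 12], Among [:: 2; 0; 0; 1; 1; 1; 1; 1; 0; 1; 0] [:: 0; 1;
      1; 1; 1] [:: ([:: 0; 9; 12], Absurd); ([:: 0; 7; 12], Absurd)]); ([:: 2; 4; 7; 9; 13],
      Among [:: 2; 1; 1; 1; 0; 0; 1; 1; 0; 1; 1] [:: 0; 1; 1; 0; 1] [:: ([:: 0; 9; 12], Absurd);
      ([:: 0; 10; 12], Absurd)]); ([:: 0; 9; 12], Absurd); ([:: 0; 10; 12], Absurd)]); ([:: 0;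
      9; 12], Absurd); ([:: 0; 10; 12], Absurd)]));
    Clash true [:: 1; 2; 3; 4; 5] [:: 6; 8] (Common 0 12 (Among [:: 2; 0; 0; 1; 1; 1; 1; 1; 1;
      1; 1] [:: 0; 1; 1] [:: ([:: 3; 5; 8; 10; 13], Among [:: 2; 1; 0; 0; 1; 1; 1; 1; 1; 0; 1]
      [:: 0; 1; 1; 1] [:: ([:: 0; 10; 12], Absurd); ([:: 0; 7; 12], Absurd)]); ([:: 0; 9; 12],
      Absurd); ([:: 0; 10; 12], Absurd)]));
    Clash true [:: 6] [:: 1; 3; 8] (Common 9 11 (Among [:: 1; 1; 0; 0; 1; 1; 1; 1; 1; 1; 1] [::
      1; 1; 1] [:: ([:: 0; 7; 10; 12; 13], Among [:: 1; 1; 1; 0; 1; 1; 1; 0; 1; 1; 1] [:: 1; 1;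
      1; 0] [:: ([:: 2; 5; 10; 12; 13], Among [:: 1; 0; 1; 1; 1; 1; 1; 0; 1; 1; 0] [:: 1; 1; 1;
      0; 1] [::]); ([:: 1; 2; 4; 9; 11], Among [:: 0; 0; 0; 0; 1; 0; 1; 0; 1; 0; 1] [:: 1; 1; 0;
      0; 0] [:: ([:: 4; 6; 12], Among [:: 1; 0; 1; 1; 1; 0; 1; 0; 1; 0; 1] [:: 1; 1; 0; 0; 0; 0]
      [:: ([:: 2; 3; 11], Absurd); ([:: 0; 8; 11], Absurd); ([:: 3; 8; 10; 11], Absurd)]); ([::
      8; 10; 11], Among [:: 1; 0; 1; 1; 0; 0; 1; 1; 1; 1; 1] [:: 1; 0; 1; 1; 0; 1] [::])])]);
      ([:: 5; 7; 10; 12; 13], Among [:: 1; 0; 0; 1; 1; 1; 1; 1; 1; 1; 0] [:: 1; 1; 1; 1]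
      [::])]));
    Clash true [:: 6] [:: 1; 3; 5; 8] (Common 9 11 (Among [:: 1; 1; 1; 0; 1; 1; 1; 0; 1; 1; 1]
      [:: 1; 1; 1] [:: ([:: 1; 2; 4; 9; 11], Among [:: 0; 0; 0; 1; 0; 0; 1; 1; 0; 1; 0] [:: 1;
      0; 0; 1] [:: ([:: 3; 6; 14], Among [:: 1; 0; 0; 1; 1; 1; 1; 1; 0; 1; 0] [:: 1; 0; 0; 1; 0]
      [:: ([:: 4; 5; 11], Absurd); ([:: 0; 9; 11], Absurd); ([:: 4; 7; 9; 11], Absurd)]); ([::
      7; 9; 11], Among [:: 1; 1; 0; 0; 1; 1; 1; 1; 1; 1; 1] [:: 1; 1; 0; 0; 1] [::])])]));
    Clash true [:: 6] [:: 0; 7; 9] (Common 1 11 (Among [:: 1; 1; 0; 0; 1; 1; 1; 1; 1; 1; 1] [::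
      1; 1; 1] [:: ([:: 5; 8; 10; 12; 13], Among [:: 1; 2; 1; 0; 0; 1; 1; 0; 1; 1; 0] [:: 2; 0;
      2; 0] [:: ([:: 0; 6; 8; 13], Among [:: 1; 1; 0; 0; 0; 0; 1; 0; 0; 1; 1] [:: 1; 1; 1; 0; 1]
      [::])])]));
    Clash true [:: 6] [:: 4; 7; 9] (Common 2 12 (Common 1 11 (Among [:: 1; 1; 1; 1; 1; 0; 1; 1;
      0; 0; 1] [:: 1; 1; 1; 1] [::])));
    Clash true [:: 6] [:: 2; 7; 9] (Common 4 12 (Common 1 11 (Among [:: 1; 2; 0; 0; 1; 1; 0; 1;
      1; 1; 0] [:: 1; 1; 1; 1] [:: ([:: 0; 7; 9; 13; 14], Among [:: 1; 1; 0; 0; 1; 1; 1; 1; 1;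
      1; 1] [:: 1; 0; 0; 1; 1] [:: ([:: 5; 8; 10; 11; 15], Among [:: 1; 0; 1; 0; 1; 1; 1; 0; 1;
      1; 0] [:: 1; 1; 1; 0; 1; 1] [::])])])));
    Clash true [:: 6] [:: 2; 4; 7; 9] (Common 1 11 (Among [:: 1; 1; 0; 1; 1; 1; 1; 1; 0; 1; 1]
      [:: 1; 1; 1] [:: ([:: 3; 5; 10; 12; 13], Among [:: 1; 2; 1; 0; 0; 1; 1; 0; 1; 1; 0] [:: 2;
      0; 2; 0] [:: ([:: 0; 6; 8; 13], Among [:: 1; 1; 0; 0; 0; 1; 0; 0; 0; 1; 0] [:: 1; 1; 0; 0;
      0] [:: ([:: 0; 9; 11], Among [:: 1; 1; 1; 1; 0; 0; 1; 0; 0; 0; 1] [:: 1; 0; 1; 1; 0; 0]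
      [:: ([:: 2; 3; 11], Absurd)]); ([:: 1; 5; 12], Among [:: 1; 2; 1; 0; 0; 1; 1; 0; 0; 0; 1]
      [:: 1; 1; 1; 1; 0; 1] [::])])])]));
    Clash true [:: 6] [:: 7; 10] (Common 1 11 (Among [:: 1; 1; 0; 1; 1; 1; 1; 1; 1; 1; 1] [:: 1;
      0; 1] [:: ([:: 3; 5; 8; 10; 13], Among [:: 1; 1; 1; 1; 1; 0; 1; 1; 1; 1; 1] [:: 1; 0; 1;
      0] [::])]));
    Clash true [:: 6] [:: 0; 7; 10] (Common 1 11 (Among [:: 1; 1; 0; 1; 1; 1; 1; 1; 1; 1; 1] [::
      1; 0; 1] [:: ([:: 3; 5; 8; 10; 13], Among [:: 1; 1; 1; 1; 0; 1; 1; 1; 1; 1; 0] [:: 1; 0;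
      1; 1] [::])]));
    Clash false [:: 6] [:: 0; 7; 10] (Common 11 12 (Among [:: 1; 0; 0; 1; 1; 0; 1; 1; 1; 1; 1]
      [:: 1; 0; 0] [::]));
    Clash true [:: 6] [:: 2; 7; 10] (Among [:: 1; 0; 0; 1; 1; 0; 1; 1; 0; 0; 1] [:: 0; 0] [::
      ([:: 3; 4; 6], Absurd); ([:: 0; 7; 10], Absurd)]);
    Clash false [:: 6] [:: 2; 7; 10] (Common 11 12 (Among [:: 1; 0; 0; 1; 1; 0; 1; 1; 0; 0; 1]
      [:: 0; 0; 0] [:: ([:: 3; 4; 6], Absurd); ([:: 0; 7; 10], Absurd)]));
    Clash true [:: 6] [:: 2; 5; 7; 10] (Among [:: 1; 0; 0; 1; 1; 0; 1; 1; 1; 1; 1] [:: 1; 0]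
      [::]);
    Clash false [:: 6] [:: 2; 5; 7; 10] (Common 11 12 (Among [:: 1; 1; 1; 0; 0; 0; 1; 1; 1; 1;
      1] [:: 1; 0; 0] [::]));
    Clash false [:: 6] [:: 7; 10] (Common 11 12 (Common 1 11 (Among [:: 1; 1; 0; 1; 1; 1; 1; 1;
      1; 1; 1] [:: 1; 0; 0; 1] [:: ([:: 3; 5; 8; 10; 14], Among [:: 1; 1; 1; 1; 0; 1; 1; 1; 1;
      1; 0] [:: 1; 0; 0; 1; 1] [::])])));
    Clash true [:: 0; 6] [:: 1; 3; 5; 8] (Common 9 11 (Among [:: 1; 1; 1; 1; 0; 0; 1; 1; 1; 2;
      1] [:: 1; 0; 1] [:: ([:: 1; 3; 6; 8; 13], Among [:: 1; 1; 0; 0; 1; 1; 1; 0; 1; 1; 1] [::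
      1; 1; 1; 1] [::]); ([:: 1; 2; 9; 11], Among [:: 1; 0; 0; 1; 1; 0; 1; 1; 1; 1; 1] [:: 1; 0;
      0; 0] [:: ([:: 4; 7; 9; 11], Absurd); ([:: 3; 8; 10; 11], Absurd)]); ([:: 2; 7; 9; 11],
      Absurd)]));
    Clash true [:: 1; 6] [:: 2; 4; 5; 7] (Common 3 11 (Among [:: 1; 1; 0; 1; 1; 1; 0; 1; 1; 1;
      1] [:: 1; 1; 1] [:: ([:: 3; 5; 8; 10; 11], Common 9 11 (Among [:: 1; 1; 0; 0; 1; 1; 0; 1;
      1; 1; 1] [:: 1; 1; 0; 1; 1] [:: ([:: 0; 8; 10; 12; 15], Among [:: 1; 1; 0; 1; 1; 1; 0; 1;
      0; 1; 1] [:: 1; 1; 0; 1; 1; 0] [::])]))]));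
    Clash true [:: 1; 6] [:: 4; 7; 9] (Common 2 12 (Common 3 11 (Among [:: 1; 1; 1; 1; 1; 0; 0;
      1; 1; 0; 1] [:: 1; 1; 1; 1] [::])));
    Clash false [:: 1; 3; 6] [:: 1; 6; 8] (Common 3 12 (Common 8 11 (Among [:: 0; 0; 0; 1; 0; 0;
      0; 0; 1; 0; 0] [:: 1; 1; 1; 1] [:: ([:: 8; 11; 13], Among [:: 1; 1; 1; 1; 0; 0; 1; 0; 1;
      1; 1] [:: 1; 1; 1; 0; 1] [::]); ([:: 3; 12; 14], Among [:: 1; 1; 1; 1; 0; 0; 1; 0; 1; 1;
      1] [:: 1; 1; 0; 1; 1] [::])])));
    Clash true [:: 1; 3; 6] [:: 4; 7; 9] (Common 2 12 (Common 8 11 (Among [:: 1; 0; 1; 1; 1; 0;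
      1; 1; 1; 0; 1] [:: 1; 1; 1; 1] [::])));
    Clash false [:: 1; 3; 6] [:: 2; 7; 9] (Common 11 12 (Common 4 12 (Among [:: 0; 0; 0; 0; 0;
      1; 1; 0; 0; 1; 0] [:: 1; 1; 1; 0] [:: ([:: 6; 9; 13], Common 4 11 (Among [:: 1; 0; 1; 1;
      1; 0; 1; 0; 0; 1; 0] [:: 1; 1; 1; 1; 1; 1] [:: ([:: 0; 9; 13; 14; 16], Among [:: 1; 0; 0;
      1; 1; 1; 1; 1; 1; 1; 1] [:: 0; 0; 0; 0; 0; 0; 0] [:: ([:: 5; 8; 10], Absurd)])])); ([:: 5;
      11; 12], Among [:: 1; 0; 1; 1; 1; 1; 1; 0; 1; 1; 0] [:: 1; 1; 0; 1; 1] [::])])));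
    Clash true [:: 1; 3; 6] [:: 5; 7; 10] (Common 2 12 (Common 8 11 (Among [:: 1; 0; 1; 1; 0; 1;
      1; 1; 1; 1; 0] [:: 1; 1; 1; 1] [:: ([:: 0; 6; 9; 12; 14], Among [:: 1; 0; 0; 1; 1; 0; 0;
      0; 1; 0; 0] [:: 1; 0; 0; 1; 0] [:: ([:: 0; 8; 11], Among [:: 1; 0; 1; 1; 0; 1; 1; 1; 1; 1;
      0] [:: 1; 1; 1; 0; 0; 1] [::]); ([:: 3; 4; 14], Absurd)])])));
    Clash true [:: 1; 3; 6] [:: 2; 7; 10] (Common 5 12 (Common 8 11 (Among [:: 1; 0; 1; 1; 1; 1;
      1; 0; 1; 1; 1] [:: 1; 1; 1; 0] [:: ([:: 2; 4; 9; 11; 13], Among [:: 1; 0; 1; 1; 1; 1; 1;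
      0; 1; 0; 1] [:: 1; 1; 1; 1; 0] [:: ([:: 2; 3; 4; 5; 14], Among [:: 1; 0; 1; 1; 0; 1; 1; 0;
      1; 1; 1] [:: 1; 1; 1; 1; 0; 0] [::])])])));
    Clash false [:: 1; 3; 6] [:: 5; 7; 10] (Common 11 12 (Common 8 11 (Common 2 12 (Among [:: 1;
      0; 1; 1; 0; 1; 1; 1; 1; 1; 0] [:: 1; 1; 0; 1; 1] [:: ([:: 0; 6; 9; 12; 14], Among [:: 1;
      0; 1; 1; 1; 1; 1; 1; 1; 0; 0] [:: 1; 1; 0; 1; 1; 0] [:: ([:: 2; 4; 5; 7; 14], Among [:: 0;
      0; 0; 1; 0; 1; 0; 0; 0; 1; 0] [:: 1; 0; 0; 1; 0; 0; 1] [::])])]))));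
    Clash false [:: 1; 3; 4; 6] [:: 1; 6; 8] (Common 3 12 (Among [:: 0; 0; 0; 1; 1; 0; 0; 0; 1;
      0; 0] [:: 1; 1; 1] [::]));
    Clash true [:: 1; 3; 4; 6] [:: 7; 9] (Common 2 12 (Among [:: 0; 0; 1; 0; 1; 0; 0; 0; 1; 0;
      0] [:: 1; 1; 1] [:: ([:: 8; 11; 13], Among [:: 1; 1; 1; 0; 0; 1; 1; 1; 1; 1; 1] [:: 0; 1;
      1; 1] [::])]));
    Clash true [:: 1; 3; 4; 6] [:: 7; 10] (Common 2 12 (Among [:: 1; 1; 1; 0; 0; 1; 0; 1; 1; 1;
      0] [:: 0; 1; 1] [::]));
    Clash false [:: 1; 3; 4; 6] [:: 7; 10] (Common 11 12 (Among [:: 1; 0; 1; 1; 1; 0; 1; 1; 1;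
      1; 1] [:: 1; 1; 1] [:: ([:: 2; 4; 7; 9; 13], Among [:: 1; 0; 0; 1; 1; 1; 1; 1; 0; 1; 1]
      [:: 1; 1; 1; 1] [::])]));
    Clash false [:: 6; 8] [:: 6; 8] (Common 1 11 (Among [:: 1; 1; 1; 1; 0; 0; 1; 0; 0; 1; 1] [::
      1; 0; 1] [::]));
    Clash false [:: 6; 8] [:: 0; 6; 8] (Common 1 11 (Among [:: 1; 1; 1; 1; 0; 0; 1; 0; 0; 1; 1]
      [:: 1; 0; 1] [::]));
    Clash false [:: 6; 8] [:: 1; 6; 8] (Among [:: 1; 0; 0; 0; 1; 1; 1; 1; 1; 0; 0] [:: 0; 0] [::
      ([:: 4; 5; 7], Absurd); ([:: 0; 6; 8], Absurd)]);
    Clash false [:: 6; 8] [:: 1; 3; 6; 8] (Among [:: 1; 0; 0; 0; 1; 1; 1; 1; 1; 0; 0] [:: 0; 0]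
      [:: ([:: 4; 5; 7], Absurd); ([:: 0; 6; 8], Absurd)]);
    Clash false [:: 6; 8] [:: 6; 9] (Among [:: 0; 0; 1; 0; 0; 0; 1; 0; 1; 0; 0] [:: 0; 0] [::
      ([:: 6; 8], Absurd)]);
    Clash false [:: 6; 8] [:: 0; 6; 9] (Among [:: 0; 0; 1; 0; 0; 0; 1; 0; 1; 0; 0] [:: 0; 0] [::
      ([:: 6; 8], Absurd)]);
    Clash false [:: 6; 8] [:: 1; 6; 9] (Among [:: 0; 0; 1; 0; 0; 0; 1; 0; 1; 0; 0] [:: 0; 0] [::
      ([:: 6; 8], Absurd)]);
    Clash false [:: 6; 8] [:: 4; 6; 9] (Among [:: 0; 0; 1; 0; 0; 0; 1; 0; 1; 0; 0] [:: 0; 0] [::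
      ([:: 6; 8], Absurd)]);
    Clash false [:: 6; 8] [:: 1; 4; 6; 9] (Among [:: 0; 0; 1; 0; 0; 0; 1; 0; 1; 0; 0] [:: 0; 0]
      [:: ([:: 6; 8], Absurd)]);
    Clash false [:: 0; 6; 8] [:: 2; 7; 9] (Common 11 12 (Among [:: 1; 1; 0; 0; 1; 1; 1; 1; 1; 1;
      1] [:: 1; 1; 1] [:: ([:: 1; 4; 6; 9; 13], Common 4 12 (Among [:: 1; 0; 1; 1; 1; 0; 1; 0;
      1; 1; 0] [:: 1; 1; 1; 1; 1] [::]))]));
    Clash false [:: 1; 6; 8] [:: 3; 6; 8] (Common 1 12 (Common 3 11 (Among [:: 1; 0; 0; 1; 1; 0;
      1; 0; 0; 0; 1] [:: 0; 1; 0; 0] [:: ([:: 0; 10; 12], Among [:: 1; 1; 1; 1; 0; 0; 0; 0; 1;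
      1; 1] [:: 1; 1; 1; 1; 1] [::]); ([:: 3; 4; 6], Absurd)])));
    Clash false [:: 1; 6; 8] [:: 4; 6; 9] (Common 3 11 Absurd);
    Clash true [:: 1; 6; 8] [:: 2; 7; 9] (Common 4 12 (Among [:: 1; 0; 1; 1; 1; 0; 1; 0; 0; 1;
      1] [:: 0; 1; 1] [:: ([:: 3; 4; 12], Absurd)]));
    Clash true [:: 1; 6; 8] [:: 4; 7; 9] (Common 3 11 (Common 2 12 (Among [:: 1; 1; 1; 1; 1; 0;
      0; 1; 1; 0; 1] [:: 1; 1; 1; 1] [::])));
    Clash false [:: 1; 6; 8] [:: 5; 8; 10] (Common 3 11 Absurd);
    Dead [:: 1] (Among [:: 1; 1; 1; 0; 0; 1; 1; 1; 1; 1; 1] [:: 0] [:: ([:: 5; 7; 10], Absurd)]);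
    Dead [:: 6] (Among [:: 0; 1; 0; 0; 0; 0; 0; 1; 0; 0; 1] [:: 0] [:: ([:: 7; 10], Absurd)]);
    Dead [:: 6; 8] (Among [:: 0; 0; 0; 0; 0; 0; 0; 0; 1; 1; 1] [:: 0] [:: ([:: 8; 10], Absurd)]);
    Clash true [:: 0] [:: 1; 6; 8] (Common 3 12 (Common 7 11 (Among [:: 1; 1; 1; 1; 0; 0; 0; 1;
      1; 1; 1] [:: 1; 1; 1; 1] [:: ([:: 2; 7; 9; 11; 13], Common 10 11 (Among [:: 1; 1; 1; 0; 0;
      1; 0; 0; 1; 1; 1] [:: 1; 1; 1; 0; 1; 1] [::])); ([:: 2; 3; 10; 12; 14], Among [:: 1; 1; 0;
      0; 1; 1; 0; 1; 1; 0; 0] [:: 0; 1; 0; 1; 1] [::])])));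
    Clash true [:: 1; 3] [:: 2; 4] (Common 8 11 (Common 7 12 (Among [:: 0; 0; 0; 0; 0; 0; 0; 1;
      1; 0; 0] [:: 1; 1; 1; 1] [::])));
    Clash true [:: 1; 3] [:: 2; 4; 7] (Common 8 11 (Common 9 12 (Among [:: 0; 0; 0; 0; 0; 0; 0;
      0; 1; 1; 0] [:: 1; 1; 1; 1] [:: ([:: 8; 11; 14], Among [:: 1; 0; 0; 1; 1; 1; 1; 1; 1; 1;
      0] [:: 1; 1; 0; 1; 1] [::]); ([:: 9; 12; 13], Among [:: 1; 0; 0; 1; 1; 1; 1; 1; 1; 1; 0]
      [:: 1; 1; 1; 0; 1] [::])])));
    Clash true [:: 1; 3] [:: 0; 6; 9] (Common 5 11 (Common 8 11 (Among [:: 0; 0; 0; 0; 0; 1; 0;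
      0; 1; 1; 0] [:: 1; 0; 1; 1] [:: ([:: 9; 13; 14], Among [:: 1; 0; 1; 1; 0; 1; 1; 1; 1; 1;
      0] [:: 1; 0; 1; 1; 1] [:: ([:: 2; 7; 9; 13; 14], Among [:: 1; 1; 1; 1; 0; 0; 1; 1; 0; 1;
      1] [:: 1; 1; 1; 0; 0; 1] [::]); ([:: 2; 5; 7; 11; 15], Among [:: 1; 0; 1; 1; 0; 0; 1; 1;
      1; 1; 0] [:: 1; 1; 0; 1; 1; 1] [::])])])));
    Clash false [:: 1; 3] [:: 1; 4; 6; 9] (Common 6 11 (Among [:: 1; 1; 1; 0; 0; 0; 1; 0; 1; 1;
      1] [:: 1; 0; 1] [::]));
    Clash true [:: 1; 3] [:: 0; 7; 9] (Among [:: 1; 1; 0; 0; 1; 1; 1; 1; 1; 1; 1] [:: 0; 0] [::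
      ([:: 1; 4; 6; 9], Absurd)]);
    Clash false [:: 1; 3] [:: 0; 7; 9] (Common 11 12 (Among [:: 1; 1; 0; 0; 1; 1; 1; 1; 1; 1; 1]
      [:: 0; 0; 0] [:: ([:: 1; 4; 6; 9], Absurd)]));
    Clash true [:: 1; 3] [:: 2; 7; 9] (Among [:: 0; 0; 0; 0; 0; 1; 0; 0; 0; 1; 0] [:: 0; 1] [::
      ([:: 5; 12], Absurd)]);
    Clash false [:: 1; 3] [:: 2; 7; 9] (Common 11 12 (Among [:: 0; 0; 0; 0; 0; 1; 0; 0; 0; 1; 0]
      [:: 0; 1; 0] [:: ([:: 5; 12], Absurd)]));
    Clash false [:: 1; 3] [:: 4; 7; 9] (Common 11 12 (Among [:: 0; 0; 0; 0; 0; 1; 0; 0; 1; 1; 0]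
      [:: 0; 0; 0] [:: ([:: 5; 8], Absurd)]));
    Clash true [:: 1; 3] [:: 2; 4; 7; 9] (Among [:: 1; 1; 0; 1; 0; 0; 0; 1; 0; 1; 1] [:: 0; 0]
      [:: ([:: 0; 7; 9], Absurd); ([:: 0; 7; 10], Absurd)]);
    Clash false [:: 1; 3] [:: 2; 4; 7; 9] (Common 11 12 (Among [:: 0; 0; 1; 0; 1; 0; 1; 0; 1; 0;
      1] [:: 1; 0; 0] [::]));
    Clash true [:: 0; 6] [:: 1; 3; 8] (Common 9 11 (Among [:: 1; 1; 1; 1; 0; 0; 1; 1; 1; 2; 1]
      [:: 1; 0; 1] [:: ([:: 1; 3; 6; 8; 13], Among [:: 1; 1; 0; 0; 1; 1; 1; 0; 1; 1; 1] [:: 1;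
      1; 1; 1] [::]); ([:: 2; 7; 9; 11], Among [:: 1; 1; 0; 0; 1; 1; 1; 1; 1; 1; 1] [:: 1; 1; 0;
      1] [::])]));
    Clash true [:: 0; 6] [:: 3; 5; 8] (Common 10 12 (Common 9 11 (Among [:: 1; 0; 0; 0; 1; 1; 1;
      1; 1; 1; 1] [:: 1; 1; 1; 1] [:: ([:: 0; 7; 10; 12; 14], Among [:: 0; 0; 0; 1; 0; 0; 1; 1;
      0; 1; 0] [:: 1; 0; 0; 1; 0] [:: ([:: 3; 6; 14], Among [:: 1; 1; 0; 0; 0; 1; 1; 0; 1; 1; 1]
      [:: 1; 1; 0; 1; 1; 1] [::]); ([:: 7; 9; 11], Among [:: 1; 0; 0; 0; 1; 1; 1; 1; 1; 1; 1]
      [:: 1; 1; 0; 0; 1; 1] [::])]); ([:: 0; 6; 8; 13; 14], Among [:: 1; 1; 1; 0; 0; 0; 0; 0; 1;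
      1; 1] [:: 1; 1; 1; 0; 0] [::])])));
    Clash true [:: 1; 6] [:: 2; 4; 7] (Common 3 11 (Among [:: 1; 1; 0; 1; 1; 1; 0; 1; 1; 0; 0]
      [:: 2; 1; 2] [:: ([:: 0; 8; 12; 13], Among [:: 1; 1; 0; 1; 1; 0; 0; 1; 1; 1; 1] [:: 1; 1;
      1; 1] [:: ([:: 4; 7; 9; 11; 14], Among [:: 1; 1; 1; 1; 0; 0; 0; 0; 0; 1; 1] [:: 1; 0; 1;
      0; 1] [::])]); ([:: 3; 5; 8; 11], Among [:: 1; 1; 0; 0; 1; 1; 0; 1; 1; 0; 0] [:: 1; 1; 0;
      1] [::])]));
    Clash false [:: 1; 6] [:: 2; 4; 5; 7] (Common 11 12 (Common 4 11 (Among [:: 1; 0; 0; 1; 2;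
      1; 1; 1; 0; 1; 1] [:: 1; 1; 0; 1] [:: ([:: 4; 7; 9; 11], Among [:: 1; 1; 0; 0; 1; 1; 1; 1;
      0; 1; 1] [:: 1; 1; 1; 0; 1] [:: ([:: 1; 4; 6; 9; 13], Among [:: 1; 0; 0; 1; 1; 1; 1; 1; 0;
      1; 0] [:: 1; 1; 1; 1; 0; 1] [::])])])));
    Clash true [:: 1; 6] [:: 3; 8] (Among [:: 1; 0; 1; 1; 0; 0; 1; 0; 0; 0; 0] [:: 1; 1] [::
      ([:: 0; 6; 12], Common 4 11 (Among [:: 0; 1; 0; 1; 0; 0; 0; 0; 0; 1; 1] [:: 1; 1; 0; 0]
      [:: ([:: 1; 9; 12], Among [:: 1; 1; 1; 1; 0; 0; 0; 0; 0; 1; 0] [:: 1; 1; 0; 1; 1] [::]);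
      ([:: 3; 10; 11], Common 5 12 (Among [:: 1; 1; 1; 1; 0; 0; 0; 0; 0; 0; 1] [:: 1; 1; 0; 0;
      1; 1] [::]))]))]);
    Clash true [:: 1; 6] [:: 3; 5; 8] (Common 4 11 (Among [:: 1; 1; 2; 1; 0; 0; 1; 0; 1; 1; 1]
      [:: 1; 1; 1] [:: ([:: 1; 3; 6; 8; 13], Among [:: 1; 0; 0; 1; 1; 1; 1; 0; 0; 0; 0] [:: 1;
      1; 1; 1] [::])]));
    Clash false [:: 1; 6] [:: 1; 3; 5; 8] (Common 3 11 (Common 4 11 (Among [:: 1; 1; 1; 0; 1; 1;
      1; 0; 1; 0; 1] [:: 1; 1; 1; 1] [::])));
    Clash false [:: 1; 6] [:: 0; 6; 8] (Common 3 11 (Common 4 11 (Among [:: 1; 1; 0; 1; 1; 1; 1;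
      1; 0; 1; 1] [:: 1; 0; 1; 1] [:: ([:: 1; 4; 6; 9; 13], Among [:: 1; 1; 0; 0; 1; 1; 0; 1; 1;
      0; 0] [:: 1; 0; 1; 1; 0] [::])])));
    Clash false [:: 1; 6] [:: 1; 6; 8] (Among [:: 1; 0; 0; 0; 1; 1; 1; 1; 1; 0; 0] [:: 0; 0] [::
      ([:: 4; 5; 7], Absurd); ([:: 0; 6; 8], Absurd)]);
    Clash false [:: 1; 6] [:: 3; 6; 8] (Among [:: 1; 0; 0; 0; 1; 1; 1; 1; 1; 0; 0] [:: 0; 0] [::
      ([:: 4; 5; 7], Absurd); ([:: 0; 6; 8], Absurd)]);
    Clash false [:: 1; 6] [:: 1; 3; 6; 8] (Among [:: 1; 0; 0; 0; 1; 1; 1; 1; 1; 0; 0] [:: 0; 0]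
      [:: ([:: 4; 5; 7], Absurd); ([:: 0; 6; 8], Absurd)]);
    Clash true [:: 1; 6] [:: 0; 7; 9] (Among [:: 0; 0; 1; 0; 0; 0; 1; 0; 1; 0; 0] [:: 0; 0] [::
      ([:: 6; 8], Absurd)]);
    Clash false [:: 1; 6] [:: 0; 7; 9] (Common 11 12 (Among [:: 0; 0; 1; 0; 0; 0; 1; 0; 1; 0; 0]
      [:: 0; 0; 0] [:: ([:: 6; 8], Absurd)]));
    Clash true [:: 1; 6] [:: 2; 7; 9] (Among [:: 0; 0; 0; 0; 0; 1; 1; 0; 0; 1; 0] [:: 0; 0] [::
      ([:: 6; 9], Absurd)]);
    Clash false [:: 1; 6] [:: 2; 7; 9] (Common 11 12 (Among [:: 0; 0; 0; 0; 0; 1; 1; 0; 0; 1; 0]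
      [:: 0; 0; 0] [:: ([:: 6; 9], Absurd)]));
    Clash false [:: 1; 6] [:: 4; 7; 9] (Common 11 12 (Among [:: 0; 0; 0; 0; 0; 1; 1; 0; 0; 1; 0]
      [:: 0; 0; 0] [:: ([:: 6; 9], Absurd)]));
    Clash true [:: 1; 6] [:: 2; 4; 7; 9] (Among [:: 0; 0; 0; 0; 0; 1; 1; 0; 0; 1; 0] [:: 0; 0]
      [:: ([:: 6; 9], Absurd)]);
    Clash false [:: 1; 6] [:: 2; 4; 7; 9] (Common 11 12 (Among [:: 0; 0; 0; 0; 0; 1; 1; 0; 0; 1;
      0] [:: 0; 0; 0] [:: ([:: 6; 9], Absurd)]));
    Clash true [:: 1; 3; 6] [:: 2; 4; 7] (Common 8 11 (Among [:: 1; 0; 0; 1; 1; 1; 1; 1; 1; 1;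
      1] [:: 1; 1; 1] [:: ([:: 3; 5; 8; 10; 12], Cases 2 [:: ([:: 0; 8; 10], Common 9 12 (Among
      [:: 1; 0; 1; 1; 0; 0; 1; 0; 1; 1; 1] [:: 1; 1; 1; 1; 1] [:: ([:: 0; 8; 10; 11; 15], Among
      [:: 1; 0; 0; 1; 1; 1; 1; 1; 1; 1; 0] [:: 1; 1; 0; 0; 1; 1] [::])])); ([:: 5; 8; 10], Among
      [:: 1; 1; 0; 0; 1; 1; 0; 1; 1; 0; 0] [:: 1; 1; 1; 0] [::])]); ([:: 0; 6; 9; 12; 13], Among
      [:: 1; 1; 0; 0; 1; 1; 0; 1; 1; 0; 0] [:: 1; 1; 1; 0] [::])]));
    Clash false [:: 1; 3; 6] [:: 2; 4; 5; 7] (Common 11 12 (Common 4 11 (Among [:: 1; 1; 0; 0;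
      1; 1; 1; 1; 0; 1; 1] [:: 1; 1; 1; 1] [:: ([:: 1; 4; 6; 9; 13], Among [:: 1; 0; 0; 1; 1; 1;
      1; 1; 0; 1; 0] [:: 1; 1; 1; 1; 1] [::])])));
    Clash false [:: 1; 3; 6] [:: 1; 3; 5; 8] (Common 4 11 (Common 8 11 (Among [:: 1; 1; 1; 0; 0;
      1; 1; 0; 1; 1; 1] [:: 1; 1; 1; 1] [:: ([:: 0; 6; 9; 12; 14], Among [:: 1; 1; 1; 0; 1; 1;
      1; 0; 1; 0; 1] [:: 1; 1; 1; 1; 0] [::])])));
    Clash false [:: 1; 3; 6] [:: 1; 6; 9] (Common 4 12 (Among [:: 1; 1; 0; 0; 1; 1; 0; 1; 1; 1;
      0] [:: 0; 1; 1] [:: ([:: 4; 5; 12], Absurd)]));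
    Clash false [:: 1; 3; 6] [:: 4; 6; 9] (Common 1 12 (Among [:: 1; 1; 0; 0; 1; 1; 1; 1; 1; 0;
      0] [:: 0; 1; 1] [:: ([:: 1; 5; 12], Absurd)]));
    Clash false [:: 1; 3; 6] [:: 3; 5; 8] (Common 4 11 (Common 10 12 (Common 1 12 (Common 8 11
      (Among [:: 1; 0; 1; 0; 0; 1; 1; 0; 1; 1; 1] [:: 1; 1; 1; 1; 0; 1] [:: ([:: 0; 6; 9; 12;
      16], Among [:: 1; 0; 1; 0; 1; 1; 1; 0; 1; 0; 1] [:: 1; 1; 1; 1; 0; 1; 0] [::])])))));
    Clash false [:: 1; 3; 6] [:: 4; 7; 9] (Common 11 12 (Common 4 11 (Common 8 11 (Common 2 12
      (Among [:: 1; 0; 1; 1; 1; 0; 1; 1; 0; 0; 1] [:: 1; 1; 0; 1; 1; 1] [::])))));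
    Clash false [:: 1; 3; 6] [:: 3; 5; 10] (Common 4 11 (Common 8 11 (Common 2 12 (Common 8 12
      (Among [:: 1; 0; 0; 1; 1; 0; 1; 1; 0; 0; 1] [:: 1; 1; 1; 1; 1; 1] [:: ([:: 3; 10; 13; 15;
      16], Among [:: 1; 0; 0; 1; 1; 0; 1; 1; 1; 0; 1] [:: 1; 0; 1; 1; 0; 1; 1] [::]); ([:: 3; 6;
      13; 14; 15], Among [:: 1; 0; 1; 1; 0; 0; 1; 0; 1; 1; 1] [:: 0; 1; 0; 1; 1; 1; 1]
      [::])])))));
    Clash false [:: 1; 3; 6] [:: 3; 8; 10] (Common 5 12 (Among [:: 1; 0; 0; 1; 1; 1; 1; 1; 0; 0;
      1] [:: 0; 1; 1] [:: ([:: 4; 5; 12], Absurd)]));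
    Clash true [:: 1; 3; 6] [:: 5; 8; 10] (Common 4 11 (Among [:: 1; 1; 1; 0; 0; 1; 0; 0; 1; 1;
      0] [:: 1; 1; 1] [::]));
    Clash false [:: 1; 3; 6] [:: 1; 3; 8] (Common 4 11 (Common 8 11 (Among [:: 1; 0; 0; 0; 1; 1;
      0; 0; 0; 0; 0] [:: 1; 0; 1; 1] [:: ([:: 4; 5; 14], Common 6 12 (Among [:: 1; 1; 1; 0; 0;
      0; 1; 0; 0; 0; 0] [:: 0; 1; 0; 0; 0; 1] [:: ([:: 1; 2; 16], Among [:: 1; 1; 1; 0; 0; 0; 1;
      0; 1; 1; 1] [:: 1; 1; 1; 1; 0; 1; 0] [::]); ([:: 0; 6; 12], Among [:: 1; 1; 1; 0; 0; 0; 1;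
      0; 1; 1; 1] [:: 1; 1; 1; 1; 0; 0; 1] [::])])); ([:: 0; 13; 14], Among [:: 1; 1; 0; 0; 0;
      0; 0; 1; 1; 0; 0] [:: 0; 0; 0; 1; 1] [:: ([:: 0; 7; 14], Among [:: 1; 1; 1; 0; 0; 0; 0; 0;
      0; 1; 1] [:: 1; 0; 1; 1; 0; 1] [::])])])));
    Clash false [:: 1; 3; 6] [:: 2; 5; 7; 10] (Common 11 12 (Among [:: 1; 0; 0; 1; 1; 1; 1; 1;
      1; 1; 1] [:: 1; 1; 1] [:: ([:: 3; 5; 8; 10; 13], Common 8 11 (Among [:: 1; 1; 1; 1; 0; 0;
      0; 1; 1; 0; 1] [:: 1; 1; 1; 1; 1] [:: ([:: 1; 2; 3; 13; 15], Among [:: 1; 0; 1; 1; 0; 0;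
      1; 1; 1; 0; 1] [:: 1; 1; 1; 1; 1; 0] [::])]))]));
    Clash false [:: 1; 3; 6] [:: 5; 8; 10] (Common 11 12 (Common 8 11 (Common 4 11 (Common 3 12
      (Among [:: 1; 0; 1; 1; 0; 1; 1; 0; 1; 1; 0] [:: 1; 1; 0; 1; 1; 1] [::])))));
    Clash false [:: 1; 6; 8] [:: 2; 4; 7; 9] (Common 11 12 (Common 3 11 (Among [:: 1; 1; 1; 1;
      0; 0; 0; 1; 1; 1; 1] [:: 1; 1; 1; 1] [:: ([:: 0; 7; 9; 13; 14], Among [:: 1; 0; 0; 1; 1;
      1; 1; 1; 0; 0; 0] [:: 1; 1; 1; 0; 0] [:: ([:: 4; 5; 13], Absurd)])])));
    Clash false [:: 1; 6; 8] [:: 4; 7; 9] (Common 11 12 (Among [:: 1; 1; 0; 0; 0; 1; 0; 0; 1; 1;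
      0] [:: 1; 0; 0] [:: ([:: 0; 9; 11], Common 2 12 (Among [:: 1; 0; 1; 1; 1; 0; 1; 1; 1; 0;
      1] [:: 1; 1; 1; 0; 1] [:: ([:: 0; 6; 8; 13; 15], Among [:: 1; 1; 0; 0; 1; 1; 0; 1; 1; 0;
      0] [:: 1; 1; 1; 0; 0; 0] [:: ([:: 4; 5; 13], Absurd)]); ([:: 2; 3; 10; 11; 12], Among [::
      1; 1; 0; 0; 1; 1; 0; 1; 1; 0; 0] [:: 1; 1; 0; 0; 0; 1] [::])])); ([:: 1; 5; 8], Absurd)]));
    Clash false [:: 1; 3; 6] [:: 0; 7; 9] (Common 11 12 (Common 4 11 (Common 8 11 (Among [:: 1;
      0; 0; 0; 1; 1; 0; 0; 0; 0; 0] [:: 1; 0; 0; 1; 1] [:: ([:: 4; 5; 15], Among [:: 1; 0; 1; 1;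
      0; 0; 1; 1; 1; 1; 1] [:: 1; 1; 1; 0; 1; 0] [:: ([:: 2; 7; 9; 13; 15], Among [:: 1; 1; 0;
      0; 1; 1; 0; 1; 0; 0; 0] [:: 1; 0; 1; 1; 0; 0; 1] [:: ([:: 4; 5; 13], Absurd)])]); ([:: 0;
      14; 15], Among [:: 1; 1; 0; 0; 1; 1; 0; 1; 1; 0; 0] [:: 1; 0; 0; 1; 1; 0] [::])]))));
    Dead [:: 1; 3] (Among [:: 0; 1; 0; 0; 0; 0; 0; 1; 0; 0; 1] [:: 0] [:: ([:: 7; 10], Absurd)]);
    Dead [:: 1; 6] (Among [:: 0; 0; 0; 0; 0; 0; 0; 0; 1; 1; 1] [:: 0] [:: ([:: 8; 10], Absurd)]);
    Clash true [::] [:: 1; 6; 8] (Common 7 11 (Common 5 11 (Among [:: 1; 0; 0; 1; 1; 1; 2; 2; 0;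
      0; 1] [:: 1; 0; 1; 1] [:: ([:: 4; 6; 13; 14], Among [:: 1; 0; 0; 0; 1; 1; 1; 1; 1; 0; 0]
      [:: 2; 2; 2; 0; 0] [:: ([:: 0; 6; 8; 11], Among [:: 1; 0; 0; 1; 0; 0; 1; 1; 0; 0; 1] [::
      1; 0; 1; 1; 0; 1] [:: ([:: 7; 10; 11], Absurd)])]); ([:: 3; 4; 11], Absurd); ([:: 5; 7;
      11], Absurd); ([:: 7; 10; 11], Absurd); ([:: 3; 4; 6], Absurd)])));
    Clash true [:: 0] [:: 1; 3; 4; 6] (Common 7 11 (Common 10 11 (Among [:: 0; 1; 0; 0; 0; 0; 0;
      1; 0; 0; 1] [:: 1; 0; 1; 1] [:: ([:: 7; 10; 11], Absurd); ([:: 1; 13; 14], Absurd)])));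
    Clash false [:: 0; 6] [:: 1; 3; 6] (Common 8 11 (Common 9 11 (Common 4 12 (Common 8 12
      (Among [:: 1; 0; 0; 1; 1; 0; 1; 1; 0; 0; 1] [:: 1; 1; 1; 1; 1; 1] [:: ([:: 0; 6; 13; 14;
      15], Among [:: 1; 0; 0; 1; 1; 0; 1; 1; 1; 0; 1] [:: 0; 1; 1; 0; 1; 1; 1] [::]); ([:: 3; 6;
      14; 15; 16], Among [:: 1; 0; 0; 1; 1; 0; 1; 1; 1; 0; 1] [:: 1; 0; 1; 1; 0; 1; 1]
      [::])])))));
    Clash true [:: 0; 6] [:: 2; 5; 7] (Common 8 11 (Common 9 11 (Common 10 12 (Common 4 12
      (Among [:: 1; 1; 0; 1; 0; 0; 0; 1; 0; 1; 1] [:: 1; 1; 1; 1; 1; 1] [::])))));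
    Clash false [:: 0; 6] [:: 2; 5; 7] (Common 11 12 (Common 10 12 (Among [:: 0; 0; 0; 0; 0; 0;
      1; 0; 0; 0; 1] [:: 1; 1; 1; 1] [:: ([:: 6; 13; 14], Among [:: 1; 0; 0; 1; 1; 0; 1; 1; 0;
      0; 0] [:: 1; 1; 1; 0; 1] [::])])));
    Clash false [:: 0; 6] [:: 0; 8] (Common 8 11 (Common 9 11 (Common 10 12 (Common 6 12 (Among
      [:: 0; 0; 0; 0; 0; 0; 1; 0; 1; 0; 0] [:: 1; 1; 1; 0; 0; 1] [:: ([:: 8; 11; 16], Among [::
      1; 1; 0; 1; 0; 0; 0; 1; 0; 1; 1] [:: 1; 1; 0; 1; 1; 1; 1] [::]); ([:: 6; 12; 13], Among
      [:: 1; 1; 0; 1; 0; 0; 0; 1; 0; 1; 1] [:: 1; 1; 1; 1; 1; 0; 1] [::])])))));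
    Clash false [:: 0; 6] [:: 1; 3; 8] (Common 11 12 (Common 8 11 (Common 9 11 (Common 6 12
      (Among [:: 1; 1; 0; 0; 1; 0; 1; 1; 1; 0; 1] [:: 1; 1; 0; 1; 1; 1] [::])))));
    Clash false [:: 0; 6] [:: 3; 5; 8] (Common 11 12 (Common 10 12 (Common 1 12 (Common 8 11
      (Among [:: 1; 1; 1; 0; 0; 0; 0; 0; 1; 0; 1] [:: 1; 2; 1; 1; 1; 1] [:: ([:: 0; 8; 10; 13;
      15], Among [:: 1; 0; 0; 0; 0; 1; 1; 1; 1; 0; 1] [:: 1; 1; 1; 1; 0; 1; 1] [::])])))));
    Clash false [:: 0; 6] [:: 1; 3; 5; 8] (Common 11 12 (Common 8 11 (Common 9 11 (Among [:: 1;
      1; 0; 0; 1; 1; 1; 1; 1; 0; 1] [:: 1; 1; 0; 1; 1] [::]))));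
    Clash false [:: 0; 6] [:: 1; 6; 8] (Common 3 12 (Common 8 11 (Common 9 11 (Among [:: 1; 1;
      0; 1; 1; 0; 0; 1; 1; 0; 1] [:: 1; 1; 1; 1; 1] [::]))));
    Clash false [:: 0; 6] [:: 3; 6; 8] (Common 1 12 Absurd);
    Clash true [:: 0; 6] [:: 2; 7; 9] (Common 8 11 Absurd);
    Clash false [:: 0; 6] [:: 2; 7; 9] (Common 11 12 (Common 9 11 (Common 4 12 (Among [:: 1; 0;
      1; 1; 1; 0; 1; 0; 0; 1; 1] [:: 1; 1; 1; 1; 1] [::]))));
    Clash true [:: 0; 6] [:: 2; 7; 10] (Common 5 12 Absurd);
    Clash false [:: 0; 6] [:: 2; 7; 10] (Common 11 12 Absurd);
    Clash false [:: 0; 6] [:: 2; 5; 7; 10] (Common 11 12 (Common 1 13 (Among [:: 1; 1; 1; 0; 0;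
      1; 0; 0; 1; 1; 0] [:: 0; 1; 1; 1] [:: ([:: 1; 5; 13], Absurd); ([:: 1; 2; 13], Absurd);
      ([:: 8; 12; 14], Absurd); ([:: 9; 12; 14], Absurd)])));
    Clash false [:: 1; 3; 6] [:: 1; 4; 6] (Common 9 12 (Common 3 12 (Common 8 11 (Common 4 11
      (Among [:: 1; 0; 1; 0; 0; 1; 1; 0; 1; 1; 0] [:: 1; 1; 1; 1; 1; 1] [::])))));
    Clash false [:: 1; 3; 6] [:: 2; 4; 7] (Common 11 12 (Common 4 11 (Common 8 11 (Common 9 12
      (Among [:: 1; 0; 0; 1; 1; 0; 1; 1; 0; 1; 1] [:: 1; 1; 0; 1; 1; 1] [::])))));
    Clash true [:: 1; 3; 6] [:: 2; 5; 7] (Common 8 11 (Common 10 12 (Among [:: 1; 0; 0; 1; 0; 1;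
      1; 1; 1; 1; 1] [:: 1; 1; 1; 1] [::])));
    Clash false [:: 1; 3; 6] [:: 2; 5; 7] (Common 11 12 (Common 4 11 (Common 8 11 (Among [:: 1;
      0; 0; 1; 1; 1; 1; 1; 0; 1; 1] [:: 1; 1; 0; 1; 1] [:: ([:: 4; 6; 9; 12; 15], Among [:: 1;
      0; 1; 1; 0; 0; 0; 0; 0; 1; 0] [:: 1; 1; 0; 1; 1; 1] [::])]))));
    Clash true [::] [:: 0; 6] (Common 2 11 (Common 5 11 (Among [:: 0; 1; 1; 0; 0; 0; 0; 0; 0; 0;
      1] [:: 1; 0; 1; 1] [:: ([:: 1; 2; 11], Absurd); ([:: 2; 10; 11], Absurd); ([:: 1; 2; 14],
      Absurd)])));
    Clash true [::] [:: 1; 3; 6] (Common 7 11 (Common 10 11 (Among [:: 0; 1; 0; 0; 0; 0; 0; 1;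
      0; 0; 1] [:: 1; 0; 1; 1] [:: ([:: 1; 13; 14], Among [:: 1; 0; 0; 0; 0; 1; 0; 1; 0; 0; 0]
      [:: 1; 0; 1; 1; 0] [:: ([:: 5; 7; 11], Absurd); ([:: 0; 7; 11], Absurd); ([:: 5; 7; 14],
      Absurd)]); ([:: 7; 10; 11], Absurd)])));
    Clash true [::] [:: 1; 3; 4; 6] (Common 7 11 (Common 10 11 (Among [:: 0; 1; 0; 0; 0; 0; 0;
      1; 0; 0; 1] [:: 1; 0; 1; 1] [:: ([:: 1; 13; 14], Among [:: 1; 0; 1; 1; 1; 0; 1; 1; 1; 1;
      1] [:: 1; 1; 1; 0; 0] [:: ([:: 0; 8; 10; 12; 13], Among [:: 0; 1; 0; 0; 0; 1; 0; 1; 1; 1;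
      0] [:: 1; 1; 1; 1; 0; 0] [:: ([:: 1; 5; 13], Absurd); ([:: 5; 12; 13], Absurd); ([:: 9;
      12; 14], Absurd)]); ([:: 2; 4; 7; 9; 11], Among [:: 1; 1; 1; 0; 0; 1; 1; 1; 1; 1; 1] [::
      1; 0; 0; 1; 0; 1] [:: ([:: 7; 10; 11], Absurd)])]); ([:: 7; 10; 11], Absurd)])));
    Clash true [:: 0] [:: 1; 3; 6] (Common 7 11 (Common 10 11 (Among [:: 0; 0; 0; 0; 0; 1; 1; 1;
      0; 0; 0] [:: 1; 0; 1; 1] [:: ([:: 5; 7; 11], Absurd); ([:: 6; 13; 14], Absurd)])));
    Clash false [:: 0] [:: 1; 3; 4; 6] (Common 11 12 (Common 6 11 (Among [:: 1; 0; 0; 1; 1; 1;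
      1; 1; 1; 1; 0] [:: 1; 1; 1; 1] [:: ([:: 0; 7; 9; 12; 14], Among [:: 0; 0; 0; 0; 1; 0; 0;
      0; 1; 0; 0] [:: 1; 1; 1; 1; 0] [::])])));
    Clash false [:: 0] [:: 1; 6; 8] (Common 11 12 (Common 3 12 Absurd));
    Clash true [:: 0] [:: 1; 3; 6; 8] (Common 7 11 (Cases 2 [:: ([:: 2; 4; 7; 9], Common 10 11
      (Among [:: 1; 0; 0; 1; 1; 1; 1; 1; 0; 1; 1] [:: 1; 1; 1; 1] [:: ([:: 0; 7; 9; 12; 14],
      Among [:: 1; 1; 1; 0; 0; 1; 1; 0; 1; 1; 1] [:: 1; 1; 1; 1; 0] [::]); ([:: 4; 7; 9; 12;
      14], Among [:: 1; 1; 1; 0; 0; 1; 1; 0; 1; 1; 1] [:: 1; 1; 1; 1; 0] [::])])); ([:: 2; 5; 7;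
      10], Common 9 11 (Cases 3 [:: ([:: 1; 4; 6; 9], Among [:: 1; 0; 1; 1; 1; 0; 1; 0; 1; 1; 1]
      [:: 1; 1; 1; 1] [::]); ([:: 2; 4; 7; 9], Among [:: 1; 0; 0; 1; 1; 1; 1; 1; 0; 1; 1] [:: 1;
      1; 1; 1] [::])]))]));
    Clash false [:: 0] [:: 1; 3; 6; 8] (Common 11 12 (Among [:: 0; 0; 0; 0; 0; 0; 1; 0; 0; 0; 1]
      [:: 1; 0; 0] [::]));
    Clash false [:: 0] [:: 1; 3; 6] (Common 11 12 (Common 8 12 (Common 6 11 (Among [:: 1; 0; 0;
      1; 0; 1; 1; 1; 1; 1; 0] [:: 1; 1; 1; 1; 1] [:: ([:: 3; 5; 8; 13; 15], Common 8 11 (Among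
      [:: 1; 0; 1; 1; 0; 0; 1; 0; 1; 1; 1] [:: 1; 1; 1; 1; 0; 0; 1] [::])); ([:: 0; 7; 9; 12;
      15], Among [:: 1; 0; 1; 1; 0; 0; 1; 0; 1; 1; 1] [:: 1; 1; 1; 1; 1; 0] [::])]))));
    Clash false [:: 0; 6] [:: 0; 7] (Common 8 11 (Common 9 11 (Common 9 12 (Common 10 12 (Among
      [:: 1; 0; 0; 0; 1; 1; 1; 1; 1; 0; 0] [:: 1; 1; 1; 1; 1; 1] [:: ([:: 0; 6; 13; 14; 16],
      Among [:: 1; 0; 0; 0; 1; 1; 1; 1; 1; 1; 0] [:: 0; 1; 0; 1; 1; 1; 1] [::]); ([:: 0; 7; 13;
      15; 16], Among [:: 1; 0; 0; 0; 1; 1; 1; 1; 1; 1; 0] [:: 1; 0; 1; 1; 1; 0; 1] [::])])))));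
    Dead [:: 0] (Among [:: 0; 1; 0; 0; 0; 0; 1; 0; 0; 0; 1] [:: 0] [:: ([:: 1; 6], Absurd)]);
    Clash true [::] [:: 1; 2; 3; 4; 5] (Common 0 11 Absurd);
    Clash true [::] [:: 0; 6; 8] (Common 1 11 (Common 2 11 (Common 5 11 (Cases 2 [:: ([:: 1; 3;
      6; 8], Among [:: 1; 1; 1; 0; 0; 0; 0; 0; 0; 0; 0] [:: 1; 0; 1; 1; 0] [:: ([:: 0; 13; 14],
      Among [:: 1; 1; 0; 0; 1; 1; 0; 1; 1; 0; 0] [:: 1; 0; 1; 1; 0; 0] [:: ([:: 4; 5; 13],
      Absurd); ([:: 1; 5; 14], Absurd)])]); ([:: 1; 4; 6; 9], Among [:: 1; 0; 0; 0; 1; 1; 0; 0;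
      0; 0; 0] [:: 1; 0; 1; 0; 1] [:: ([:: 0; 13; 15], Among [:: 1; 1; 1; 1; 0; 0; 0; 0; 0; 1;
      1] [:: 1; 0; 1; 0; 1; 0] [:: ([:: 2; 3; 13], Absurd); ([:: 1; 2; 15], Absurd)])])]))));
    Clash false [::] [:: 0; 6; 8] (Common 11 12 (Common 0 11 Absurd));
    Clash true [::] [:: 1; 3; 6; 8] (Among [:: 1; 0; 1; 0; 1; 0; 1; 0; 1; 0; 1] [:: 0; 0] [::
      ([:: 0; 6; 8], Absurd); ([:: 0; 8; 10], Absurd)]);
    Dead [::] (Among [:: 0; 0; 0; 0; 0; 0; 0; 0; 0; 1; 1] [:: 1] [::])].

(** * The choice of a rotation *)

Definition coexist (en en' : entry) := compatible true en en' || compatible false en en'.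

(* Three traces any two of which can occur together, but not all three. *)
Definition triad : seq (seq nat) := [:: [:: 1; 3; 4; 6]; [:: 2; 4; 5; 7]; [:: 1; 2; 4; 9]].

(** Property D for m = 2, applied to P_1, P_2, Q_0, Q_3 and the first and third vertex of the triad:
    no vertex sees three of these six. *)
Definition triad_tree := Among [:: 0; 0; 1; 1; 0; 0; 1; 0; 0; 1; 0] [:: 1; 0; 1] [::].

Definition has_triad (L : seq entry) :=
  has (fun p => all (fun X => indicator X \in [seq permute p (etrace en) | en <- L]) triad)
    symmetries.

(* The types a, b, c, u, v, w, x, y are numbered 0 to 7 as in vega_vertex, and the
   letters A, B, C are 8, 9, 10. *)
Definition vega_types : seq (seq nat * nat) :=
  [:: ([:: 1; 2; 3; 4; 5], 0); ([:: 1; 4; 6; 9], 1); ([:: 1; 3; 6; 8], 2);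
      ([:: 2; 5; 7; 10], 3); ([:: 0; 7; 9], 4); ([:: 0; 8; 10], 5);
      ([:: 0; 7; 10], 6); ([:: 1; 3; 4; 6], 7);
      ([:: 0; 6; 8], 8); ([:: 0; 6; 9], 8); ([:: 0; 6], 8);
      ([:: 3; 5; 8; 10], 9); ([:: 2; 3; 5; 10], 9); ([:: 3; 8; 10], 9); ([:: 3; 5; 10], 9);
      ([:: 2; 4; 7; 9], 10); ([:: 2; 4; 5; 7], 10); ([:: 4; 7; 9], 10); ([:: 2; 4; 7], 10)].

Definition vega_traces : seq bitseq := [seq indicator q.1 | q <- vega_types].

Definition vega_type (s : bitseq) : nat :=
  nth 0 (unzip2 vega_types) (index s vega_traces).

(** The list [symmetries] begins with the five maps k |-> k + r. *)
Definition rotations := take 5 symmetries.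

(* Whenever each rotation in ps gets an entry whose trace it fails to turn into a Vega
   trace, these entries and those of L contain two that cannot coexist, or the triad. *)
Fixpoint stuck (tab : seq entry) (ps : seq (seq nat)) (L : seq entry) : bool :=
  match ps with
  | [::] => has_triad L
  | p :: ps' =>
    all (fun en => if (permute p (etrace en) \in vega_traces) || ~~ all (coexist en) L then true
                   else stuck tab ps' (en :: L)) tab
  end.

Definition rotation_certified (tab : seq entry) : bool :=
  check tab triad_tree (State [seq with_trace tab X | X <- triad] [::])
  && stuck tab rotations [::].

(** The whole finite search runs in this one computation; the form of the statement avoids writing
    down the resulting table. *)
Lemma certificate_correct :
  if run certificate initial_table is Some tab then rotation_certified tab else false.
Proof. by vm_compute. Qed.

Section Rotation.

Variables (T : finType) (e : rel T).
Hypotheses (e_simple : simple_graph e) (e_max : maximal_triangle_free e).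
Hypothesis e_D : property_D 4 e.

(** A rotation that fails does so at some vertex of G. The entries of these vertices, collected in
    [L], pairwise coexist because the vertices are really there, and they do not contain the triad;
    [stuck] says that not all rotations can fail in this way. *)
Lemma stuck_sound tab f ps L :
  valid e tab -> embedding e f -> {subset ps <= symmetries} ->
  check tab triad_tree (State [seq with_trace tab X | X <- triad] [::]) ->
  stuck tab ps L ->
  {in L, forall en, en \in tab /\ exists x, etrace en = trace e f x} ->
  exists2 p, p \in ps & forall x, permute p (trace e f x) \in vega_traces.
Proof.
move=> V f_emb + Ctri; elim: ps L => [|p ps IH] L psub.
  move=> /hasP[p psym /allP ptri] LT; exfalso.
  have f'_emb := embedding_symmetry psym f_emb.
  have ex i : i < 3 -> exists x, trace e (f \o nth 0 p) x = indicator (nth [::] triad i).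
    move=> lti; have /mapP[en enL ->] := ptri _ (@mem_nth _ [::] triad i lti).
    by have [_ [x ->]] := LT en enL; exists x; rewrite trace_symmetry.
  have [x0 E0] := ex 0 isT; have [x1 E1] := ex 1 isT; have [x2 E2] := ex 2 isT.
  apply: (check_sound e_simple e_max e_D f'_emb V (z := nth x0 [:: x0; x1; x2]) Ctri).
  by split=> // -[|[|[|//]]] _; apply: (realizes_traces V f'_emb).
move=> St LT; case: (pickP (fun x => permute p (trace e f x) \notin vega_traces)) => [x xbad|all_good].
  have [_ Vtr Vco] := V; have [en ten tren] := Vtr f f_emb x.
  have /allP/(_ en ten) := St; rewrite tren (negbTE xbad) /=.
  have -> /= : all (coexist en) L.
    apply/allP => en' /LT[ten' [y tren']]; have := Vco f f_emb x y en en' ten ten' tren tren'.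
    by rewrite /coexist; case: (e x y) => ->; rewrite ?orbT.
  move=> St'; have psub' : {subset ps <= symmetries}.
    by move=> q qps; apply: psub; rewrite inE qps orbT.
  have [|q qps qgood] := IH (en :: L) psub' St'; last by exists q => //; rewrite inE qps orbT.
  by move=> en'; rewrite inE => /orP[/eqP->|/LT //]; split=> //; exists x.
exists p; first exact: mem_head.
by move=> x; apply/negPn; rewrite all_good.
Qed.

Lemma good_embedding f :
  embedding e f ->
  exists2 f', embedding e f' & forall x, trace e f' x \in vega_traces.
Proof.
move=> f_emb; have := certificate_correct.
case R : (run certificate initial_table) => [tab|//] /andP[Ctri St].
have V := run_valid e_simple e_max e_D R (initial_table_valid e_max).
have sub : {subset rotations <= symmetries} by move=> p; apply: mem_take.
have [|p /sub ps good] := stuck_sound V f_emb sub Ctri St; first by [].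
exists (f \o nth 0 p); first exact: embedding_symmetry.
by move=> x; rewrite trace_symmetry.
Qed.

End Rotation.

(* P_k is a_(2k), Q_k is b_(2k) and o is c. *)
Definition residue5 (m : nat) : 'I_5 := Ordinal (ltn_pmod m (isT : 0 < 5)).

Definition MG_of (v : nat) : MG_vertex :=
  if v == 0 then None
  else if v <= 5 then Some (inl (residue5 (2 * (v - 1))))
  else Some (inr (residue5 (2 * (v - 6)))).

(** Any two distinct nonadjacent vertices of the Groetzsch graph have a common neighbour, so an
    additional edge between their images would complete a triangle. Hence the subgraph is
    induced. *)
Lemma embedding_of_subgraph (T : finType) (e : rel T) :
  simple_graph e -> triangle_free e -> contains_subgraph MG_adj e ->
  exists f, embedding e f.
Proof.
move=> [sym irr] tf [phi [_ phiP]]; exists (phi \o MG_of) => u v lt_u lt_v.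
have edge a b : a < 11 -> b < 11 -> groetzsch a b -> e (phi (MG_of a)) (phi (MG_of b)).
  move=> lta ltb ab; apply: phiP.
  have /allP/(_ a) : all (fun a => all (fun b => groetzsch a b ==> MG_adj (MG_of a) (MG_of b))
    (iota 0 11)) (iota 0 11) by vm_compute.
  by rewrite mem_iota lta => /(_ isT)/allP/(_ b); rewrite mem_iota ltb ab => /(_ isT).
have /allP/(_ u) : all (fun u => all (fun v => [|| u == v, groetzsch u v |
    has (fun w => groetzsch u w && groetzsch v w) (iota 0 11)])
    (iota 0 11)) (iota 0 11) by vm_compute.
rewrite mem_iota lt_u => /(_ isT)/allP/(_ v); rewrite mem_iota lt_v => /(_ isT).
have [<- _|_] := eqVneq u v.
  rewrite /= irr; apply/esym/negbTE; have /allP/(_ u) :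
    all (fun u => ~~ groetzsch u u) (iota 0 11) by vm_compute.
  by rewrite mem_iota lt_u => /(_ isT).
rewrite orFb; case uv: (groetzsch u v); first by rewrite /= edge.
rewrite orFb => /hasP[w]; rewrite mem_iota => /andP[_ lt_w] /andP[uw vw]; apply/negP => /= euv.
by have /negP := tf (phi (MG_of u)) (phi (MG_of v)) (phi (MG_of w)); rewrite euv !edge.
Qed.

(** * Types and ranks *)

(** Between letters these pairs only say which adjacencies are allowed; the ranks will decide which
    are present. *)
Definition type_edges : seq (nat * nat) :=
  vega_hex_edges ++
  [:: (8, 0); (8, 3); (9, 1); (9, 4); (10, 2); (10, 5); (8, 9); (9, 10); (10, 8)].

Definition type_adj (s t : nat) : bool := ((s, t) \in type_edges) || ((t, s) \in type_edges).

(* The cyclic symmetry a -> b -> c, u -> v -> w, A -> B -> C. *)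
Definition turn (s : nat) : nat := nth 0 [:: 1; 2; 0; 4; 5; 3; 6; 7; 9; 10; 8] s.

Lemma forall_lt11 (P : pred nat) : all P (iota 0 11) -> forall s, s < 11 -> P s.
Proof. by move=> /allP H s lt_s; apply: H; rewrite mem_iota. Qed.

Lemma type_adj_sym s t : type_adj s t = type_adj t s.
Proof. by rewrite /type_adj orbC. Qed.

Lemma type_adj_turn s t : s < 11 -> t < 11 -> type_adj (turn s) (turn t) = type_adj s t.
Proof.
move=> lts ltt; have := forall_lt11 (P := fun s => all (fun t =>
  type_adj (turn s) (turn t) == type_adj s t) (iota 0 11)) isT lts.
by move=> /forall_lt11/(_ _ ltt)/eqP.
Qed.

Lemma turn_lt s : s < 11 -> turn s < 11.
Proof. exact: (forall_lt11 (P := fun s => turn s < 11) isT). Qed.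

Lemma turn_ge8 s : s < 11 -> (8 <= turn s) = (8 <= s).
Proof.
by move=> lts; have /eqP := forall_lt11 (P := fun s => (8 <= turn s) == (8 <= s)) isT lts.
Qed.

(** * Oriented walks between letters *)

Section Order.

Variables (T : finType) (e : rel T).
Hypotheses (e_simple : simple_graph e) (e_max : maximal_triangle_free e).
Hypothesis e_D : property_D 4 e.
Variable ty : T -> nat.
Hypothesis ty_lt : forall x, ty x < 11.
Hypothesis ty_edge : forall x y, e x y -> type_adj (ty x) (ty y).
Hypothesis ty_onto : forall s, s < 7 -> exists x, ty x = s.

Let e_sym : symmetric e := proj1 e_simple.

(** Nonadjacent vertices have a common neighbour, whose type would form a triangle with theirs; but
    the only triangle in the graph of types is A, B, C. *)
Lemma edge_of_type x y :
  ~~ ((8 <= ty x) && (8 <= ty y)) -> e x y = type_adj (ty x) (ty y).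
Proof.
move=> nW; apply/idP/idP => [/ty_edge//|xy]; apply/negPn/negP => /negbTE nxy.
have [z /andP[xz yz]] := common_neighbour e_simple e_max (isT : 0 < 4) e_D nxy.
have := forall_lt11 (P := fun s => all (fun t => all (fun r =>
  [|| (8 <= s) && (8 <= t), ~~ type_adj s t, ~~ type_adj s r | ~~ type_adj t r])
  (iota 0 11)) (iota 0 11)) isT (ty_lt x).
move=> /forall_lt11/(_ _ (ty_lt y))/forall_lt11/(_ _ (ty_lt z)).
by rewrite (negbTE nW) xy !ty_edge.
Qed.

Definition step (x y : T) := [&& 8 <= ty x, ty y == turn (ty x) & e x y].

Lemma step_ge8 x y : step x y -> (8 <= ty x) && (8 <= ty y).
Proof. by move=> /and3P[x8 /eqP-> _]; rewrite turn_ge8 // x8. Qed.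

(** The third letter is the only type adjacent to two different letters, so the common neighbour
    supplied by maximality has this letter. *)
Lemma between x y :
  8 <= ty x -> ty y = turn (ty x) -> e x y = false -> exists2 z, step y z & step z x.
Proof.
move=> x8 yx /(common_neighbour e_simple e_max (isT : 0 < 4) e_D)[z /andP[xz yz]].
have := forall_lt11 (P := fun s => all (fun r => [|| s < 8, ~~ type_adj s r,
  ~~ type_adj (turn s) r | [&& 8 <= turn s, r == turn (turn s), 8 <= r & s == turn r]])
  (iota 0 11)) isT (ty_lt x) => /forall_lt11/(_ _ (ty_lt z)).
rewrite ltnNge x8 (ty_edge xz) -yx (ty_edge yz) /= => /and4P[y8 zy z8 xz'].
by exists z; rewrite /step ?y8 ?zy ?z8 ?xz' //= e_sym.
Qed.

Lemma turn4 s : s < 11 -> 8 <= s -> turn (turn (turn (turn s))) = turn s.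
Proof.
move=> lts s8; apply/eqP; move: s lts s8.
have : all (fun s => (8 <= s) ==> (turn (turn (turn (turn s))) == turn s)) (iota 0 11) by [].
by move=> /forall_lt11 H s /H/implyP.
Qed.

(* Twelve vertices, each y seeing at most four of them: y cannot see two
   consecutive vertices of the walk, and its type bounds the rest. *)
Lemma no_closed_six_walk a b c d g h :
  step a b -> step b c -> step c d -> step d g -> step g h -> step h a -> False.
Proof.
move=> ab bc cd dg gh ha.
have [h0 t0] := ty_onto (isT : 0 < 7); have [h1 t1] := ty_onto (isT : 1 < 7).
have [h2 t2] := ty_onto (isT : 2 < 7); have [h3 t3] := ty_onto (isT : 3 < 7).
have [h4 t4] := ty_onto (isT : 4 < 7); have [h5 t5] := ty_onto (isT : 5 < 7).
have [y] := property_D_count (m := 4) e_D isT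
  (erefl : size [:: a; b; c; d; g; h; h0; h1; h2; h3; h4; h5] = 3 * 4).
apply/negP; rewrite -leqNgt.
have nadj x z : step x z -> ~~ (e x y && e z y).
  move=> /and3P[_ _ xz]; apply/negP => /andP[xy zy].
  exact: (triangleF e_max xz xy zy).
have W x : e x y ==> type_adj (ty x) (ty y) by apply/implyP/ty_edge.
(* In this finite check [s] is the type of [a], [t] that of [y], and the six bits of [bs] tell which
   vertices of the walk [y] sees. *)
have := forall_lt11 (P := fun s => all (fun t => all (fun bs => (8 <= s) ==>
   [&& ~~ (nth false bs 0 && nth false bs 1), ~~ (nth false bs 1 && nth false bs 2),
       ~~ (nth false bs 2 && nth false bs 3), ~~ (nth false bs 3 && nth false bs 4),
       ~~ (nth false bs 4 && nth false bs 5), ~~ (nth false bs 5 && nth false bs 0)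
     & all (fun i => nth false bs i ==> type_adj (iter i turn s) t) (iota 0 6)] ==>
   (count id bs + count (type_adj t) (iota 0 6) <= 4)) (bitseqs 6)) (iota 0 11)).
have a8 : 8 <= ty a by case/and3P: ab.
move=> /(_ ltac:(vm_compute; reflexivity) _ (ty_lt a))/forall_lt11/(_ _ (ty_lt y)).
move=> /allP/(_ [:: e a y; e b y; e c y; e d y; e g y; e h y] (mem_bitseqs (erefl _))).
rewrite a8 !nadj //=.
have Eb : ty b = turn (ty a) by case/and3P: ab => _ /eqP.
have Ec : ty c = turn (ty b) by case/and3P: bc => _ /eqP.
have Ed : ty d = turn (ty c) by case/and3P: cd => _ /eqP.
have Eg : ty g = turn (ty d) by case/and3P: dg => _ /eqP.
have Eh : ty h = turn (ty g) by case/and3P: gh => _ /eqP.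
have B i x : ty x = i -> e x y <= type_adj (ty y) i.
  by move=> <-; rewrite type_adj_sym; case E : (e x y) => //; rewrite ty_edge.
rewrite -Eb -Ec -Ed -Eg -Eh !W /= => le4; apply: leq_trans le4.
rewrite !addn0 -!addnA !leq_add2l.
by do 5![apply: leq_add; first exact: B]; exact: B.
Qed.

(** Four steps turn the letter as one step does. If p and q were not adjacent, [between] would give
    a vertex t closing p, a, b, c, q, t to a walk of six steps. *)
Lemma step_chord p a b c q :
  step p a -> step a b -> step b c -> step c q -> step p q.
Proof.
move=> pa ab bc cq; have /andP[p8 _] := step_ge8 pa.
have qp : ty q = turn (ty p).
  case/and3P: pa => _ /eqP Ea _; case/and3P: ab => _ /eqP Eb _.
  case/and3P: bc => _ /eqP Ec _; case/and3P: cq => _ /eqP Eq _.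
  by rewrite Eq Ec Eb Ea turn4.
case pq : (e p q); first by rewrite /step p8 qp eqxx pq.
have [t qt tp] := between p8 qp pq.
by case: (no_closed_six_walk pa ab bc cq qt tp).
Qed.

Lemma turn_neq s : s < 11 -> 8 <= s -> (turn s != s) && (turn (turn s) != s).
Proof.
move=> lts; have := forall_lt11 (P := fun s => (8 <= s) ==>
  ((turn s != s) && (turn (turn s) != s))) isT lts.
by move=> /implyP.
Qed.

(* By step_chord every walk shortens to one with at most three steps. *)
Definition reach (p q : T) :=
  [|| step p q, [exists a, step p a && step a q]
    | [exists a, exists b, [&& step p a, step a b & step b q]]].

(** One or two steps change the letter, and a closed walk of three steps is a triangle. *)
Lemma reach_irr p : reach p p = false.
Proof.
apply/negP => /or3P[pp|/existsP[a /andP[pa ap]]|/existsP[a /existsP[b /and3P[pa ab bp]]]].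
- have /andP[p8 _] := step_ge8 pp; have /andP[/negP[]] := turn_neq (ty_lt p) p8.
  by case/and3P: pp => _; rewrite eq_sym.
- have /andP[p8 _] := step_ge8 pa; have /andP[_ /negP[]] := turn_neq (ty_lt p) p8.
  by case/and3P: pa => _ /eqP <- _; case/and3P: ap => _; rewrite eq_sym.
case/and3P: pa => _ _ pa; case/and3P: ab => _ _ ab; case/and3P: bp => _ _ bp.
by apply: (triangleF e_max pa _ ab); rewrite e_sym.
Qed.

Lemma reach_step p q r : reach p q -> step q r -> reach p r.
Proof.
move=> pq qr; apply/or3P.
case/or3P: pq => [pq|/existsP[a /andP[pa aq]]|/existsP[a /existsP[b /and3P[pa ab bq]]]].
- by apply: Or32; apply/existsP; exists q; rewrite pq.
- by apply: Or33; apply/existsP; exists a; apply/existsP; exists q; rewrite pa aq.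
- by apply: Or31; apply: step_chord qr; eassumption.
Qed.

(** * Ranks *)

Fixpoint ends_walk (k : nat) (q : T) : bool :=
  if k is k'.+1 then [exists p, ends_walk k' p && step p q] else 8 <= ty q.

(** Along a step from p to q the set of vertices reaching the endpoint grows strictly: it gains p,
    which does not reach itself. *)
Lemma ends_walk_bound k q : ends_walk k q -> k <= #|[set p | reach p q]|.
Proof.
elim: k q => // k IH q /existsP[p /andP[/IH le_k pq]].
apply: leq_ltn_trans le_k _; apply: proper_card; apply/properP; split.
  by apply/subsetP => r; rewrite !inE => /reach_step; apply.
by exists p; rewrite inE ?reach_irr // /reach pq.
Qed.

(** By the preceding bound no walk has more than [#|T|] steps, so this maximum takes all walks
    ending at [q] into account. *)
Definition rank (q : T) : nat := \max_(k < #|T|.+1 | ends_walk k q) k.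

Lemma leq_rank k q : ends_walk k q -> k <= rank q.
Proof.
move=> kq; have lt_k : k < #|T|.+1 by rewrite ltnS (leq_trans (ends_walk_bound kq)) ?max_card.
exact: (leq_bigmax_cond (Ordinal lt_k)).
Qed.

Lemma ends_walk_rank q : 8 <= ty q -> ends_walk (rank q) q.
Proof.
move=> q8; rewrite /rank.
have : 0 < #|[pred k : 'I_#|T|.+1 | ends_walk k q]| by apply/card_gt0P; exists ord0.
by move=> /(eq_bigmax_cond (fun k : 'I_#|T|.+1 => k : nat))[k kq ->].
Qed.

Lemma step_rank p q : step p q -> rank p < rank q.
Proof.
move=> pq; apply: leq_rank; apply/existsP; exists p; rewrite pq andbT.
by apply: ends_walk_rank; case/andP: (step_ge8 pq).
Qed.

(** Take the last vertex before [q] on a longest walk; a longer walk to it would give a longer one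
    to [q]. *)
Lemma rank_pred q k : 8 <= ty q -> rank q = k.+1 -> exists2 p, step p q & rank p = k.
Proof.
move=> q8 rq; have := ends_walk_rank q8; rewrite rq => /existsP[p /andP[kp pq]].
exists p => //; apply/eqP; rewrite eqn_leq leq_rank // andbT -ltnS -rq.
exact: step_rank.
Qed.

(** If p and q are not adjacent, there are steps from q to some t and from t to p, so q has smaller
    rank than p. *)
Lemma edge_rank p q : 8 <= ty p -> ty q = turn (ty p) -> e p q = (rank p < rank q).
Proof.
move=> p8 qp; apply/idP/idP => [pq|lt_pq].
  by apply: step_rank; rewrite /step p8 qp eqxx.
apply/negPn/negP => /negbTE npq; have [t qt tp] := between p8 qp npq.
by have := ltn_trans (step_rank qt) (step_rank tp); rewrite ltnNge ltnW.
Qed.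

Lemma rank_lower q k : 8 <= ty q -> k <= rank q -> exists2 p, 8 <= ty p & rank p = k.
Proof.
elim: {q}(rank q) {-2}q (erefl (rank q)) => [|n IH] q rq q8.
  by rewrite rq leqn0 => /eqP->; exists q.
rewrite rq leq_eqVlt => /orP[/eqP->|]; first by exists q.
have [p pq rp] := rank_pred q8 rq; rewrite ltnS -rp.
by apply: (IH p rp); case/andP: (step_ge8 pq).
Qed.

(** Two different letters are consecutive in one order. Then either the vertices are adjacent and
    the second has larger rank, or [between] gives a step into the first; rank 0 excludes both. *)
Lemma rank0_type p q :
  8 <= ty p -> 8 <= ty q -> rank p = 0 -> rank q = 0 -> ty p = ty q.
Proof.
move=> p8 q8 p0 q0.
have no x y : 8 <= ty x -> rank x = 0 -> rank y = 0 -> ty y <> turn (ty x).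
  move=> x8 x0 y0 yx; case xy : (e x y).
    by move: (xy); rewrite (edge_rank x8 yx) x0 y0.
  by have [t yt tx] := between x8 yx xy; have := step_rank tx; rewrite x0.
have := forall_lt11 (P := fun s => all (fun t => [|| s < 8, t < 8, s == t,
  t == turn s | s == turn t]) (iota 0 11)) isT (ty_lt p).
move=> /forall_lt11/(_ _ (ty_lt q)); rewrite [ty p < 8]ltnNge p8 [ty q < 8]ltnNge q8 /=.
by case/or3P => /eqP // E; [case: (no p q) | case: (no q p)].
Qed.

(** Going back along a longest walk, each step undoes one turn, and at rank 0 all letters agree. *)
Lemma type_of_rank p q :
  8 <= ty p -> rank p = 0 -> 8 <= ty q -> ty q = iter (rank q) turn (ty p).
Proof.
move=> p8 p0; elim: {q}(rank q) {-2}q (erefl (rank q)) => [|n IH] q rq q8.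
  by rewrite rq; apply/esym/rank0_type.
have [r rq' rr] := rank_pred q8 rq; rewrite rq /= -rr -(IH r rr); first by case/and3P: rq' => _ /eqP.
by case/andP: (step_ge8 rq').
Qed.

End Order.

(** * Assembling the Vega graph *)

(* Reading the vertices of the Andrasfai graph in the order
   0, i, 2i, 1, i + 1, 2i + 1, 2, ... makes k and l adjacent iff the later one
   is 1 more than the earlier one modulo 3. *)
Definition position (i k : nat) : nat := (k %% 3) * i + k %/ 3.

Lemma position_cases i k :
  k < 3 * i - 1 ->
  [\/ [/\ k = 3 * (k %/ 3), k %% 3 = 0, position i k = k %/ 3 & k %/ 3 < i],
      [/\ k = 3 * (k %/ 3) + 1, k %% 3 = 1, position i k = i + k %/ 3 & k %/ 3 < i] |
      [/\ k = 3 * (k %/ 3) + 2, k %% 3 = 2, position i k = 2 * i + k %/ 3 & k %/ 3 < i - 1]].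
Proof.
rewrite /position; have := divn_eq k 3; have := ltn_pmod k (isT : 0 < 3).
case: (k %% 3) => [|[|[|//]]] _ Ek lt_k; [apply: Or31|apply: Or32|apply: Or33]; split; lia.
Qed.

Lemma andrasfai_adjE i j m :
  j < 3 * i - 1 -> m < 3 * i - 1 ->
  andrasfai_adj i j m =
  if m <= j then i <= j - m < 2 * i else i <= j + (3 * i - 1) - m < 2 * i.
Proof.
move=> ltj ltm; rewrite /andrasfai_adj; case: (leqP m j) => mj.
  have -> : j + (3 * i - 1) - m = (j - m) + (3 * i - 1) by lia.
  by rewrite modnDr modn_small //; lia.
by rewrite modn_small //; lia.
Qed.

(** Write k = 3a + r and l = 3b + s. If s = r + 1, the positions differ by i + b - a, which lies in
    {i, ..., 2i - 1} iff a <= b. If r = 2 and s = 0, they differ by 2i + a - b, in this range iff a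
    < b. If r = s, they differ by less than i. *)
Lemma andrasfai_position i k l :
  k < 3 * i - 1 -> l < 3 * i - 1 ->
  andrasfai_adj i (position i k) (position i l)
    || andrasfai_adj i (position i l) (position i k) =
  (l %% 3 == k.+1 %% 3) && (k < l) || (k %% 3 == l.+1 %% 3) && (l < k).
Proof.
move=> ltk ltl.
have [kC lC] := (position_cases ltk, position_cases ltl).
have pk : position i k < 3 * i - 1 by case: kC => -[]; lia.
have pl : position i l < 3 * i - 1 by case: lC => -[]; lia.
rewrite !andrasfai_adjE //.
by case: kC => -[Ek _ -> kq]; case: lC => -[El _ -> lq]; do 2?case: ifP => ?; lia.
Qed.

Lemma type_adj_letter s r : s < 8 -> r < 3 -> type_adj s (8 + r) = (s == r) || (s == r + 3).
Proof. by case: s => [|[|[|[|[|[|[|[|//]]]]]]]]; case: r => [|[|[|//]]]. Qed.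

(** * The map onto the Vega graph *)

Section Assembly.

Variables (T : finType) (e : rel T) (ty rk : T -> nat) (L : nat).
Hypothesis e_sym : symmetric e.
Hypothesis e_D : property_D 4 e.
Hypothesis ty_lt : forall x, ty x < 11.
Hypothesis ty_edge : forall x y, e x y -> type_adj (ty x) (ty y).
Hypothesis edge_ty : forall x y,
  ~~ ((8 <= ty x) && (8 <= ty y)) -> e x y = type_adj (ty x) (ty y).
Hypothesis ty_rk : forall x, 8 <= ty x -> ty x = 8 + rk x %% 3.
Hypothesis edge_rk : forall x y, 8 <= ty x -> 8 <= ty y -> e x y =
  (rk y %% 3 == (rk x).+1 %% 3) && (rk x < rk y)
  || (rk x %% 3 == (rk y).+1 %% 3) && (rk y < rk x).
Hypothesis rk_lt : forall x, 8 <= ty x -> rk x < L.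
Hypothesis rk_onto : forall k, k < L -> exists2 x, 8 <= ty x & rk x = k.
Hypothesis ty_onto : forall s, s < 7 -> exists x, ty x = s.
Hypothesis L_gt3 : 3 < L.

(* Otherwise no y sees three of: a first vertex p, a last vertex q, and one
   vertex of each of the types a, c, u, w. *)
Lemma L_mod3 : L %% 3 != 0.
Proof.
apply/negP => /eqP L0.
have [p p8 rp] := rk_onto (ltn_trans (isT : 0 < 3) L_gt3).
have [|q q8 rq] := rk_onto (k := L.-1); first by lia.
have [h0 t0] := ty_onto (isT : 0 < 7); have [h2 t2] := ty_onto (isT : 2 < 7).
have [h3 t3] := ty_onto (isT : 3 < 7); have [h5 t5] := ty_onto (isT : 5 < 7).
have [y] := property_D_count (m := 2) e_D isT (erefl : size [:: p; q; h0; h2; h3; h5] = 3 * 2).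
apply/negP; rewrite -leqNgt /=.
have B i x : ty x = i -> e x y <= type_adj i (ty y).
  by move=> <-; case E : (e x y) => //; rewrite ty_edge.
(* The conditions [t != 10] and [t != 8] sharpen the count by types: a neighbour of p of type C
   would have rank below 0, and a neighbour of q of type A rank above L - 1. *)
have := forall_lt11 (P := fun t => (type_adj 8 t && (t != 10)) + ((type_adj 10 t && (t != 8)) +
  (type_adj 0 t + (type_adj 2 t + (type_adj 3 t + type_adj 5 t)))) <= 2) isT (ty_lt y).
apply: leq_trans; rewrite addn0.
apply: leq_add; last apply: leq_add; last by do 3![apply: leq_add; first exact: B]; exact: B.
  case py : (e p y) => //; have := ty_edge py; rewrite (ty_rk p8) rp => -> /=.
  rewrite lt0b; apply/negP => /eqP y10; have y8 : 8 <= ty y by rewrite y10.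
  by move: py (ty_rk y8); rewrite edge_rk // rp y10; lia.
case qy : (e q y) => //; have := ty_edge qy; have := ty_rk q8; rewrite rq.
have -> : 8 + L.-1 %% 3 = 10 by lia.
move=> -> -> /=; rewrite lt0b; apply/negP => /eqP y8'; have y8 : 8 <= ty y by rewrite y8'.
by have := rk_lt y8; move: qy (ty_rk y8); rewrite edge_rk // rq y8'; lia.
Qed.

Lemma vega_blowup :
  exists (i : nat) (mu nu : bool), 2 <= i /\ blowup_of e (@vega_adj i) (@vega_set i mu nu).
Proof.
(* For L = 3i - 1 the whole Andrasfai graph occurs. For L = 3i - 2 just the rank 3i - 2 is missing,
   and its position is 2i - 1, the vertex deleted when [nu] holds. *)
pose i := (L + 2) %/ 3; pose nu := L %% 3 == 1; pose mu := ~~ [exists x, ty x == 7].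
have LE : L = 3 * i - 1 - nu /\ 2 <= i.
  rewrite /i /nu; have := divn_eq L 3; have := divn_eq (L + 2) 3.
  have := ltn_pmod L (isT : 0 < 3); have := ltn_pmod (L + 2) (isT : 0 < 3).
  by case: (L %% 3) L_mod3 => [|[|[|//]]] //= _; lia.
case: LE => LE i2; exists i, mu, nu; split=> //.
have n0 : 0 < 3 * i - 1 by lia.
(* Positions of ranks are always in range, so the default [Ordinal n0] never takes effect on
   letters. *)
pose f x : vega_vertex i := if ty x < 8 then inr (inord (ty x))
                            else inl (insubd (Ordinal n0) (position i (rk x))).
have lt_rk x : 8 <= ty x -> rk x < 3 * i - 1 by move=> /rk_lt; lia.
have pos_lt k : k < 3 * i - 1 -> position i k < 3 * i - 1.
  by move=> /position_cases[] []; lia.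
have fV x : 8 <= ty x -> exists2 j : 'I_(3 * i - 1), f x = inl j & j = position i (rk x) :> nat.
  move=> x8; rewrite /f ltnNge x8 /=; eexists; first by [].
  by rewrite val_insubd pos_lt ?lt_rk.
have fT x : ty x < 8 -> exists2 s : 'I_8, f x = inr s & s = ty x :> nat.
  by move=> x8; rewrite /f x8; eexists; first by []; rewrite inordK.
exists f; split=> [x|].
  case: (ltnP (ty x) 8) => [/fT[s -> sE]|x8].
    rewrite unfold_in /= sE; apply/negP => /andP[/negP nex ty7].
    by apply: nex; apply/existsP; exists x.
  have [j -> jE] := fV x x8; rewrite unfold_in /= jE; apply/negP => /andP[nu1 /eqP].
  have := rk_lt x8; rewrite LE nu1; have := position_cases (lt_rk x x8).
  by case=> -[]; lia.
split=> [[j|s]|x y].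
- rewrite unfold_in /= => jnu.
  (* This inverts [position]: the vertex q i + r comes from the rank 3 r + q. *)
  pose k := 3 * (j %% i) + j %/ i.
  have := divn_eq j i; have := ltn_pmod j (ltnW i2); have := ltn_ord j.
  set q := j %/ i => ltj ltm jE; have q3 : q < 3 by nia.
  have kL : k < L.
    rewrite /k -/q LE; move: jnu; case: (nu) => /= [jn|_].
      by have : j != 2 * i - 1 :> nat by []; case: q q3 jE => [|[|[|//]]] _ jE; lia.
    by case: q q3 jE => [|[|[|//]]] _ jE; lia.
  have [x x8 xk] := rk_onto kL; exists x; have [j' -> j'E] := fV x x8.
  congr inl; apply: val_inj; rewrite /= j'E xk /k -/q /position.
  have -> : (3 * (j %% i) + q) %% 3 = q by lia.
  have -> : (3 * (j %% i) + q) %/ 3 = j %% i by lia.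
  by rewrite -jE.
- rewrite unfold_in /= => smu; have [x xs] : exists x, ty x = s.
    (* Type 7, the vertex y, is not covered by [ty_onto]; if it belongs to the set, [mu] is false
       and some vertex has this type. *)
    case: (ltnP s 7) => [/ty_onto//|s7].
    have s7' : s = 7 :> nat by have := ltn_ord s; lia.
    move: smu; rewrite s7' eqxx andbT negbK => /existsP[x /eqP xs].
    by exists x; rewrite xs.
  exists x; have [|s' -> s'E] := fT x; first by rewrite xs.
  by congr inr; apply: val_inj; rewrite /= s'E.
rewrite /vega_adj; case: (ltnP (ty x) 8) => [x8|x8]; case: (ltnP (ty y) 8) => [y8|y8].
- have [s -> sE] := fT x x8; have [t -> tE] := fT y y8.
  rewrite edge_ty ?[8 <= ty x]leqNgt ?x8 //= sE tE /type_adj /type_edges !mem_cat.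
  by rewrite !inE !xpair_eqE; case: (ty x) x8 => [|[|[|[|[|[|[|[|]]]]]]]] //;
     case: (ty y) y8 => [|[|[|[|[|[|[|[|]]]]]]]].
- have [s -> sE] := fT x x8; have [j -> jE] := fV y y8.
  rewrite edge_ty ?[8 <= ty x]leqNgt ?x8 //= sE jE (ty_rk y8) orbF.
  rewrite type_adj_letter ?ltn_pmod //.
  by case: (position_cases (lt_rk y y8)) => -[_ -> -> kq]; lia.
- have [s -> sE] := fT y y8; have [j -> jE] := fV x x8.
  rewrite edge_ty ?[8 <= ty y]leqNgt ?y8 ?andbF //= sE jE (ty_rk x8) type_adj_sym.
  rewrite type_adj_letter ?ltn_pmod //.
  by case: (position_cases (lt_rk x x8)) => -[_ -> -> kq]; lia.
have [j -> jE] := fV x x8; have [l -> lE] := fV y y8.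
by rewrite edge_rk //= jE lE andrasfai_position ?lt_rk.
Qed.

End Assembly.

(** * From traces to the hypotheses of the assembly *)

Lemma vega_type_lt s : vega_type s < 11.
Proof.
rewrite /vega_type; set k := index _ _; case: (ltnP k (size (unzip2 vega_types))) => [lt_k|le_k].
  exact: (all_nthP 0 (isT : all (gtn 11) (unzip2 vega_types))).
by rewrite nth_default.
Qed.

Lemma iter_turn k s : 8 <= s < 11 -> iter k turn s = 8 + (s - 8 + k) %% 3.
Proof.
move=> /andP[s8 s11]; elim: k => [|k IH] /=; first by lia.
have lt3 : (s - 8 + k) %% 3 < 3 by rewrite ltn_pmod.
rewrite IH; have -> : (s - 8 + k.+1) %% 3 = ((s - 8 + k) %% 3).+1 %% 3 by lia.
by case: ((s - 8 + k) %% 3) lt3 => [|[|[|//]]].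
Qed.

Lemma iter_turn_props c s t :
  s < 11 -> t < 11 ->
  [/\ iter c turn s < 11, (8 <= iter c turn s) = (8 <= s)
    & type_adj (iter c turn s) (iter c turn t) = type_adj s t].
Proof.
move=> lts ltt; suff [] : [/\ iter c turn s < 11, iter c turn t < 11,
    (8 <= iter c turn s) = (8 <= s)
    & type_adj (iter c turn s) (iter c turn t) = type_adj s t] by [].
elim: c => //= c [l1 l2 <- <-].
by rewrite !turn_lt // turn_ge8 // type_adj_turn.
Qed.

Lemma type_adj_irr s : s < 11 -> type_adj s s = false.
Proof. by move=> lts; have /negbTE := forall_lt11 (P := fun s => ~~ type_adj s s) isT lts. Qed.

Theorem theorem1p3 (T : finType) (e : rel T) :
  simple_graph e ->
  maximal_triangle_free e ->
  contains_subgraph MG_adj e ->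
  property_D 4 e ->
  exists (i : nat) (mu nu : bool),
    2 <= i /\ blowup_of e (@vega_adj i) (@vega_set i mu nu).
Proof.
move=> simp mx sub D; have [sym _] := simp.
have [f0 f0_emb] := embedding_of_subgraph simp (proj1 mx) sub.
have [f f_emb f_good] := good_embedding simp mx D f0_emb.
pose ty x := vega_type (trace e f x).
have ty_lt x : ty x < 11 by apply: vega_type_lt.
have ty_edge x y : e x y -> type_adj (ty x) (ty y).
  (* Adjacent vertices have disjoint traces, and a computation shows that disjoint Vega traces have
     adjacent types. *)
  move=> xy; have H : all (fun s => all (fun t =>
    disjoint_bits s t ==> type_adj (vega_type s) (vega_type t)) vega_traces) vega_traces.
    by vm_compute.
  have /allP/(_ _ (f_good y)) := allP H _ (f_good x).
  by rewrite (trace_disjoint mx).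
have ty_f v : v < 11 -> ty (f v) = vega_type [seq groetzsch u v | u <- iota 0 11].
  move=> lt_v; congr vega_type; apply/eq_in_map => u.
  by rewrite mem_iota => /andP[_ lt_u]; apply: f_emb.
clearbody ty.
have ty_onto s : s < 7 -> exists x, ty x = s.
  (* The vertices o, Q_4, Q_1, Q_0, P_2, P_3, P_0 of the copy itself have the types a, b, c, u, v,
     w, x. *)
  move=> lts; exists (f (nth 0 [:: 0; 10; 7; 6; 3; 4; 1] s)).
  by case: s lts => [|[|[|[|[|[|[|//]]]]]]] _; rewrite ty_f; vm_compute.
pose rk := rank e ty.
have edge_rk x y : 8 <= ty x -> ty y = turn (ty x) -> e x y = (rk x < rk y).
  exact: (edge_rank simp mx D ty_lt ty_edge ty_onto).
have stp u v : u < 11 -> v < 11 -> groetzsch u v -> 8 <= ty (f u) ->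
    ty (f v) = turn (ty (f u)) -> step e ty (f u) (f v).
  by move=> lu lv uv u8 uvt; rewrite /step u8 uvt eqxx f_emb.
(* The other four vertices of the copy form a walk P_4, Q_3, Q_2, P_1 with letters A, B, C, A; this
   makes the number of ranks exceed 3. *)
have long : 3 <= rk (f 2).
  apply: (leq_rank simp mx D ty_lt ty_edge ty_onto).
  apply/existsP; exists (f 8); rewrite stp ?ty_f // andbT.
  apply/existsP; exists (f 9); rewrite stp ?ty_f // andbT.
  by apply/existsP; exists (f 5); rewrite stp ?ty_f.
have f2 : 8 <= ty (f 2) by rewrite ty_f.
have lower := rank_lower simp mx D ty_lt ty_edge ty_onto.
have [p p8 p0] := lower _ 0 f2 (leq0n _).
(* All values up to the largest rank occur, so the number of ranks is M + 1. *)
pose M := \max_(x | 8 <= ty x) rk x.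
have [q q8 qM] : exists2 q, 8 <= ty q & M = rk q.
  have : 0 < #|[pred x | 8 <= ty x]| by apply/card_gt0P; exists p.
  by move=> /(eq_bigmax_cond rk)[q q8 qM]; exists q.
have ty_rank x : 8 <= ty x -> ty x = 8 + (ty p - 8 + rk x) %% 3.
  move=> x8; rewrite (type_of_rank simp mx D ty_lt ty_edge ty_onto p8 p0 x8).
  by rewrite iter_turn // p8 ty_lt.
(* Applying [turn] c times takes the letter of rank 0 to A; the types are relabelled accordingly by
   an automorphism of the graph of types. *)
have [c [c3 cE]] : exists c, c < 3 /\ c = (11 - ty p) %% 3.
  by exists ((11 - ty p) %% 3); rewrite ltn_pmod.
have [ty' ty'E] : exists ty', forall x, ty' x = iter c turn (ty x) by exists (iter c turn \o ty).
have ty'8 x : (8 <= ty' x) = (8 <= ty x) by rewrite ty'E; have [] := iter_turn_props c (ty_lt x) (ty_lt x).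
have ty'_adj x y : type_adj (ty' x) (ty' y) = type_adj (ty x) (ty y).
  by rewrite !ty'E; have [] := iter_turn_props c (ty_lt x) (ty_lt y).
have plt := ty_lt p.
apply: (@vega_blowup T e ty' rk M.+1) => //.
- by move=> x; rewrite ty'E; have [] := iter_turn_props c (ty_lt x) (ty_lt x).
- by move=> x y /ty_edge; rewrite ty'_adj.
- move=> x y; rewrite !ty'8 ty'_adj.
  exact: (edge_of_type simp mx D ty_lt ty_edge).
- move=> x; rewrite ty'8 => x8; have xr := ty_rank x x8.
  by rewrite ty'E iter_turn ?x8 ?ty_lt // xr cE; lia.
- move=> x y; rewrite !ty'8 => x8 y8.
  have [xr yr] := (ty_rank x x8, ty_rank y y8).
  have turnE z : 8 <= ty z -> turn (ty z) = 8 + (ty z - 8).+1 %% 3.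
    by move=> z8; rewrite -[turn _]/(iter 1 turn _) iter_turn ?z8 ?ty_lt // addn1.
  have [yx|nyx] := eqVneq (rk y %% 3) ((rk x).+1 %% 3).
    have E : ty y = turn (ty x) by rewrite turnE // xr yr; lia.
    by rewrite (edge_rk _ _ x8 E); lia.
  have [xy|nxy] := eqVneq (rk x %% 3) ((rk y).+1 %% 3).
    have E : ty x = turn (ty y) by rewrite turnE // xr yr; lia.
    by rewrite sym (edge_rk _ _ y8 E); lia.
  (* If neither residue follows the other modulo 3, they are equal, and so are the letters. *)
  apply/negP => /ty_edge; have -> : ty x = ty y by rewrite xr yr; lia.
  by rewrite type_adj_irr.
- by move=> x; rewrite ty'8 ltnS => x8; apply: leq_bigmax_cond.
- move=> k; rewrite ltnS qM => /(lower _ _ q8)[x x8 xk].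
  by exists x; rewrite ?ty'8.
(* [turn] has order three, so a vertex whose old type is s turned 2c times gets the new type s. *)
- move=> s lts; have [|x xs] := ty_onto (iter (2 * c) turn s).
    by case: (c) c3 => [|[|[|//]]] _; case: s lts => [|[|[|[|[|[|[|//]]]]]]].
  exists x; rewrite ty'E {}xs.
  by case: (c) c3 => [|[|[|//]]] _; case: s lts => [|[|[|[|[|[|[|//]]]]]]].
by rewrite ltnS (leq_trans long) // leq_bigmax_cond.
Qed.
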